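(* There exists a Banach holomorphic function space $X$ on the open unit disk $\mathbb{D}$, containing the polynomials as a dense subspace, but not admitting any linear polynomial approximation scheme.
   Context: $\mathbb{D}$ denotes the open unit disk in $\mathbb{C}$, and $\mathrm{Hol}(\mathbb{D})$ the Fréchet space of holomorphic functions on $\mathbb{D}$ with the topology of uniform convergence on compact sets. A Banach holomorphic function space on $\mathbb{D}$ is a (complex) Banach space $X$ that is a subset (linear subspace) of $\mathrm{Hol}(\mathbb{D})$ such that the inclusion map $X\hookrightarrow\mathrm{Hol}(\mathbb{D})$ is continuous. A linear polynomial approximation scheme for $X$ is a sequence of continuous linear operators $T_n:X\to X$ such that, for each $f\in X$, the functions $T_n(f)$ are polynomials and $\|T_n(f)-f\|_X\to0$ as $n\to\infty$. *)

(* Defs.v *)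
From HB Require Import structures.
From mathcomp Require Import all_boot all_order all_algebra complex.
From mathcomp Require Import all_classical all_reals all_analysis.

Set Implicit Arguments.
Unset Strict Implicit.
Unset Printing Implicit Defensive.

Import Order.TTheory GRing.Theory Num.Theory.
Import numFieldNormedType.Exports.

Local Open Scope classical_set_scope.
Local Open Scope ring_scope.
Local Open Scope complex_scope.

(* MathComp-Analysis puts the usual topology on R[i] through its regular
   module R[i]^o. *)
Definition cplx (R : realType) : normedModType R[i] := R[i]^o.

Definition unit_disk (R : realType) : set (cplx R) := [set z | `|z| < 1].
Arguments unit_disk R : clear implicits.

Definition compact_in_disk (R : realType) (K : set (cplx R)) : Prop :=
  compact K /\ K `<=` unit_disk R.

(* A function on the disk is represented by a total function on R[i] of which
   only the values on the disk are meaningful: the topology below, the notion of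
   holomorphy and all the identifications of functions ignore the other values. *)
Definition disk_fun (R : realType) : topologicalType :=
  {family @compact_in_disk R, cplx R -> cplx R}.

(* The increment in [derivable _ z 1] ranges over R[i], so this is complex
   differentiability. *)
Definition holomorphic_on_disk (R : realType) (f : cplx R -> cplx R) : Prop :=
  forall z, unit_disk R z -> derivable f z (1 : R[i]^o).

Definition eq_on_disk (R : realType) (f g : cplx R -> cplx R) : Prop :=
  forall z, unit_disk R z -> f z = g z.

Record banachHolSpace (R : realType) := BanachHolSpace {
  bhs_sort :> completeNormedModType R[i] ;
  bhs_incl : {linear bhs_sort -> (cplx R -> cplx R)} ;
  bhs_incl_inj : forall f g : bhs_sort,
    eq_on_disk (bhs_incl f) (bhs_incl g) -> f = g ;
  bhs_incl_hol : forall f : bhs_sort, holomorphic_on_disk (bhs_incl f) ;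
  bhs_incl_continuous : continuous (bhs_incl : bhs_sort -> disk_fun R) }.

Definition represents_poly (R : realType) (X : banachHolSpace R) (f : X)
    (p : {poly R[i]}) : Prop :=
  eq_on_disk (bhs_incl X f) (fun z => p.[z]).

Definition polynomials (R : realType) (X : banachHolSpace R) : set X :=
  [set f : X | exists p : {poly R[i]}, represents_poly f p].
Arguments polynomials {R} X.

Definition contains_polynomials (R : realType) (X : banachHolSpace R) : Prop :=
  forall p : {poly R[i]}, exists f : X, represents_poly f p.

Definition linear_poly_approx_scheme (R : realType) (X : banachHolSpace R)
    (T : nat -> {linear X -> X}) : Prop :=
  [/\ forall n, continuous (T n),
      forall (f : X) (n : nat), polynomials X (T n f)
    & forall f : X, T n f @[n --> \oo] --> f].

(* Main.v *)
Require Import Defs.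
From HB Require Import structures.
From mathcomp Require Import all_boot all_order all_algebra complex.
From mathcomp Require Import all_classical all_reals all_analysis.
From mathcomp Require Import ring lra.

Set Implicit Arguments.
Unset Strict Implicit.
Unset Printing Implicit Defensive.

Import Order.TTheory GRing.Theory Num.Theory.
Import numFieldNormedType.Exports.

Local Open Scope classical_set_scope.
Local Open Scope ring_scope.
Local Open Scope complex_scope.

(** A linear polynomial approximation scheme forces a strong form of the
bounded approximation property: by Baire's theorem each operator of the scheme
maps the whole space into polynomials of bounded degree, hence has finite rank,
and the operators are uniformly bounded. So it suffices to realize, as a space
of holomorphic functions with the polynomials dense, a Banach space without
that property. The space is an explicit variant of the one of Davie.

The coordinates of a vector are indexed by words [x : word k], for all levels
[k], and a vector [a] is seen through its values
  [ev a g = \sum_(x : word k) a_x sigma_x(g) + \sum_(y : word k.+1) a_y tau_y(g)]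
at the points [g : point k]; the norm is the supremum of these values and the
space is the closure of the finitely supported vectors. Two properties of the
signs [sigma] and [tau] matter.
- On the points of level [k] the functions [sigma_x] and [tau_y] are all
  orthogonal. A coordinate is therefore an average of values against a sign, so
  it is bounded by the norm, and a coordinate of level [k.+1] can be computed
  in two ways: from the points of level [k] through [tau], and from those of
  level [k.+1] through [sigma] ([coef_ev], [coef_ev_tau]).
- The averages of [tau_y(g) tau_y(h) - sigma_x(g) sigma_x(h)] and of
  [tau_y(g) sigma_y(h)] are of order [2^-k] ([tau_sub_sigma_coherence],
  [tau_sigma_coherence]).

For an operator [T] let [block_trace k T] be the average over [x : word k] of
the coordinate [x] of [T e_x]. Computing the coordinates of level [k.+1] through
[tau] and those of level [k] through [sigma] exhibits the difference of two
consecutive traces as an average of values of [T] at vectors [test_vec g], whose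
norm is at most [2 / 2^k] by the second property. Hence, for operators bounded by
[M], the traces of level at least [K] differ from the one of level [K] by at
most [4 M / 2^K]. An operator whose range involves only finitely many levels
has zero traces at high levels, so for [K] large its trace of level [K] is at
most 1/2. But if [T_n] tends pointwise to the identity, then its trace of level
[K] tends to the one of the identity, which is 1: a contradiction
([davie_no_finite_scheme]).

The signs are explicit. A word of level [k] is a sequence of [k] blocks of four
bits, and all sums factor over the blocks. On four bits there are six
monomials of degree two, and the sum over the block of the sign of a nonzero
combination of them plus a linear form is at most 8 in modulus, half the number
of terms ([char_sum_le]); this halving in each block is what yields [2^-k].
Five of the monomials are paired with five extra bits of the points, which makes
room for [tau] next to [sigma], and the sixth twists [sigma] against [tau].

Finally the levels are enumerated by a bijection with the natural numbers, and a
vector is sent to the power series with its coordinates as coefficients. The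
coefficients are bounded by the norm, so this is a continuous injection into
the holomorphic functions on the disk, under which the finitely supported
vectors become the polynomials. *)

(** * Quadratic phases on a block of four bits *)

Definition bits4 : finType := (bool * bool * bool * bool)%type.
Definition bits6 : finType := (bits4 * bool * bool)%type.

Definition xor4 (a b : bits4) : bits4 :=
  let: (a1, a2, a3, a4) := a in let: (b1, b2, b3, b4) := b in
  (a1 (+) b1, a2 (+) b2, a3 (+) b3, a4 (+) b4).

Definition xor6 (d e : bits6) : bits6 :=
  let: (d', d5, d6) := d in let: (e', e5, e6) := e in
  (xor4 d' e', d5 (+) e5, d6 (+) e6).

Definition dot4 (a b : bits4) : bool :=
  let: (a1, a2, a3, a4) := a in let: (b1, b2, b3, b4) := b in
  (a1 && b1) (+) (a2 && b2) (+) (a3 && b3) (+) (a4 && b4).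

(** Six independent quadratic parts are needed: one for each bit of a block, one to
separate [sigma] from [tau] on the same points, and one for the twist between
them. Four is the least number of bits with that many products of two bits. *)
Definition quad (d : bits6) (b : bits4) : bool :=
  let: (d1, d2, d3, d4, d5, d6) := d in let: (b1, b2, b3, b4) := b in
  [&& d1, b1 & b2] (+) [&& d2, b1 & b3] (+) [&& d3, b1 & b4] (+)
  [&& d4, b2 & b3] (+) [&& d5, b2 & b4] (+) [&& d6, b3 & b4].

Definition zero4 : bits4 := (false, false, false, false).
Definition zero6 : bits6 := (zero4, false, false).

(** Explicit lists, on which counting reduces by computation. *)
Definition bools := [:: true; false].
Definition enum_bits4 : seq bits4 :=
  [seq (x, d) | x <- [seq (x, c) | x <- [seq (a, b) | a <- bools, b <- bools],
                                   c <- bools], d <- bools].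
Definition enum_bits6 : seq bits6 :=
  [seq (x, d) | x <- [seq (x, c) | x <- enum_bits4, c <- bools], d <- bools].

Definition phase (a : bits4) (d : bits6) (b : bits4) := dot4 a b (+) quad d b.

Lemma mem_enum_bits4 b : b \in enum_bits4.
Proof. by move: b => [[[[] []] []] []]. Qed.
Lemma mem_enum_bits6 b : b \in enum_bits6.
Proof. by move: b => [[[[[[] []] []] []] []] []]. Qed.

(** A form with a nonzero quadratic part is not affine, hence is unbalanced by at
most half; the 1024 forms are checked by computation. *)
Lemma count_phase (a : bits4) (d : bits6) :
  if d == zero6
  then count (phase a d) enum_bits4 == (if a == zero4 then 0 else 8)%N
  else (4 <= count (phase a d) enum_bits4 <= 12)%N.
Proof.
pose ok a d := if d == zero6
  then count (phase a d) enum_bits4 == (if a == zero4 then 0 else 8)%N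
  else (4 <= count (phase a d) enum_bits4 <= 12)%N.
have H : all (fun a => all (ok a) enum_bits6) enum_bits4 by vm_compute.
by have /allP/(_ _ (mem_enum_bits6 d)) := allP H _ (mem_enum_bits4 a).
Qed.

(** Products of signs of phases are again signs of phases: this reduces all the
correlations of blocks to single character sums. *)
Lemma phaseD a a' d d' b :
  phase (xor4 a a') (xor6 d d') b = phase a d b (+) phase a' d' b.
Proof.
rewrite /phase addbACA; congr (_ (+) _).
  move: a a' b => [[[p1 p2] p3] p4] [[[q1 q2] q3] q4] [[[b1 b2] b3] b4] /=.
  rewrite !andb_addl; move: (p1 && b1) (p2 && b2) (p3 && b3) => r1 r2 r3.
  by rewrite (addbACA r1) (addbACA (r1 (+) r2)) (addbACA (r1 (+) r2 (+) r3)).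
move: d d' b => [[[[[p1 p2] p3] p4] p5] p6] [[[[[q1 q2] q3] q4] q5] q6].
move=> [[[b1 b2] b3] b4] /=; rewrite !andb_addl.
move: (p1 && _) (p2 && _) (p3 && _) (p4 && _) (p5 && _) => r1 r2 r3 r4 r5.
rewrite (addbACA r1) (addbACA (r1 (+) r2)) (addbACA (r1 (+) r2 (+) r3)).
by rewrite (addbACA (r1 (+) _ (+) _ (+) _)) (addbACA (r1 (+) _ (+) _ (+) _ (+) _)).
Qed.

Lemma xor4_eq0 a a' : (xor4 a a' == zero4) = (a == a').
Proof.
move: a a' => [[[p1 p2] p3] p4] [[[q1 q2] q3] q4].
by rewrite /= !xpair_eqE !eqbF_neg -!negb_eqb !negbK.
Qed.

Lemma xor6_eq0 d d' : (xor6 d d' == zero6) = (d == d').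
Proof.
move: d d' => [[d5 p5] p6] [[d5' q5] q6].
by rewrite /= !xpair_eqE [xor4 _ _ == _]xor4_eq0 !eqbF_neg -!negb_eqb !negbK.
Qed.

Lemma dot4C a b : dot4 a b = dot4 b a.
Proof.
move: a b => [[[p1 p2] p3] p4] [[[q1 q2] q3] q4] /=.
by rewrite ![_ && q1]andbC ![_ && q2]andbC ![_ && q3]andbC ![_ && q4]andbC.
Qed.

Lemma phase0 a b : phase a zero6 b = dot4 a b.
Proof. by move: b => [[[? ?] ?] ?]; rewrite /phase /= addbF. Qed.

Section signs.
Variable F : numFieldType.

Definition sgn (b : bool) : F := (-1) ^+ b.

Lemma sgnD a b : sgn (a (+) b) = sgn a * sgn b.
Proof. by rewrite /sgn signr_addb. Qed.
Lemma sgnK a : sgn a * sgn a = 1.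
Proof. by rewrite -sgnD addbb. Qed.
Lemma norm_sgn a : `|sgn a| = 1.
Proof. by rewrite /sgn normr_sign. Qed.

Definition char_sum a d : F := \sum_(b : bits4) sgn (phase a d b).

Lemma char_sumE a d :
  char_sum a d = 16 - (count (phase a d) enum_bits4)%:R *+ 2.
Proof.
rewrite /char_sum.
have -> : \sum_b sgn (phase a d b) = \sum_(b <- enum_bits4) sgn (phase a d b).
  rewrite -big_enum; apply: perm_big; apply: uniq_perm => //; first exact: enum_uniq.
  by move=> b; rewrite mem_enum mem_enum_bits4.
have sgnE b : sgn b = 1 - b%:R *+ 2 by case: b; rewrite /sgn ?expr1 ?expr0 /=; ring.
under eq_bigr do rewrite sgnE.
rewrite sumrB sumrMnl -natr_sum; congr (_ - _%:R *+ _).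
  by rewrite big_const_seq iter_addr addr0 count_predT.
by elim: enum_bits4 => [|b s IH]; rewrite ?big_nil// big_cons IH.
Qed.

Lemma char_sum0 a : char_sum a zero6 = 16 * (a == zero4)%:R.
Proof.
rewrite char_sumE; have := count_phase a zero6.
by rewrite eqxx => /eqP ->; case: eqP => _ /=; ring.
Qed.

Lemma char_sum_le a d : d != zero6 -> `|char_sum a d| <= 8.
Proof.
move=> d0; rewrite char_sumE; have := count_phase a d; rewrite (negbTE d0).
move: (count _ _) => c /andP[c4 c12].
have -> : 16 - c%:R *+ 2 = (8 - c%:R) *+ 2 :> F by ring.
have c4' : 4 <= c%:R :> F by rewrite (ler_nat _ 4).
have c12' : c%:R <= 12 :> F by rewrite (ler_nat _ _ 12).
have H : `|8 - c%:R| <= 4 :> F.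
  rewrite real_ler_norml ?rpredB ?realn//; apply/andP; split.
    by rewrite lerBrDl lerBlDr (_ : 8 + 4 = 12)//; ring.
  by rewrite lerBlDr (_ : 8 = 4 + 4) ?lerD2l//; ring.
by rewrite normrMn [leRHS](_ : _ = 4 *+ 2) ?lerMn2r//; ring.
Qed.

Lemma char_sumM a d a' d' :
  \sum_b sgn (phase a d b) * sgn (phase a' d' b) = char_sum (xor4 a a') (xor6 d d').
Proof. by apply: eq_bigr => b _; rewrite phaseD sgnD. Qed.

Lemma char_sumM_eq a a' d :
  \sum_b sgn (phase a d b) * sgn (phase a' d b) = 16 * (a == a')%:R.
Proof.
have d0 : xor6 d d = zero6 by apply/eqP; rewrite xor6_eq0.
by rewrite char_sumM d0 char_sum0 xor4_eq0.
Qed.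

Lemma char_sumM_le a d a' d' : d != d' ->
  `|\sum_b sgn (phase a d b) * sgn (phase a' d' b)| <= 8.
Proof. by move=> dd'; rewrite char_sumM char_sum_le// xor6_eq0. Qed.

(** The roles of the linear form and of its argument are exchanged: here the sum
runs over the forms, and only the quadratic part is left. *)
Lemma dual_char_sum b d b' d' :
  \sum_a sgn (phase a d b) * sgn (phase a d' b') =
  16 * (b == b')%:R * (sgn (quad d b) * sgn (quad d' b')).
Proof.
under eq_bigr do rewrite /phase !sgnD mulrACA dot4C (dot4C _ b') -!(phase0 _ _).
by rewrite -mulr_suml char_sumM_eq.
Qed.
End signs.

(** * The sign functions sigma and tau *)

Section system.
Variable F : numFieldType.
Local Notation sgn := (@sgn F).

Definition word k : finType := {ffun 'I_k -> bits4}.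
(** A point [(a, (c, t))] consists of one linear form per block and of five further
bits, the coefficients of quadratic monomials common to all blocks. *)
Definition point k : finType := (word k * (bits4 * bool))%type.

(** Without the last coefficient [true], this would be the character of the group of
points attached to [x] and to the sums over its blocks of five quadratic monomials. The
sixth monomial does not depend on the point: it leaves the correlations of
[sigma] with itself unchanged and makes [sigma] incoherent with [tau]. *)
Definition sigma k (x : word k) (g : point k) : F :=
  \prod_(i < k) sgn (phase (g.1 i) (g.2.1, g.2.2, true) (x i)).

Definition init_word k (y : word k.+1) : word k :=
  [ffun i => y (widen_ord (leqnSn k) i)].

(** The last block of [y] is paired with the bits [c], which leaves only [t] as a
quadratic coefficient. The sign [sgn t] separates these characters from those
of [sigma]: the coefficient of [t] in the exponent of [tau] is one plus the
value that it has in that of [sigma] whenever the linear parts agree. *)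
Definition tau k (y : word k.+1) (g : point k) : F :=
  (\prod_(i < k) sgn (phase (g.1 i) (zero4, g.2.2, false) (init_word y i)))
  * (sgn g.2.2 * sgn (dot4 g.2.1 (y ord_max))).

Lemma init_wordP k (y y' : word k.+1) :
  init_word y = init_word y' -> y ord_max = y' ord_max -> y = y'.
Proof.
move=> /ffunP e emax; apply/ffunP => i.
have [ik|] := ltnP i k; last first.
  rewrite leq_eqVlt => /orP[/eqP ki|]; last by rewrite ltnNge -ltnS ltn_ord.
  by have -> : i = ord_max by apply/val_inj.
have := e (Ordinal ik); rewrite !ffunE.
by have -> : widen_ord (leqnSn k) (Ordinal ik) = i by apply/val_inj.
Qed.

Lemma card_word k : #|word k| = (16 ^ k)%N.
Proof. by rewrite card_ffun card_ord !card_prod card_bool. Qed.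

Lemma sum_word k (P : 'I_k -> bits4 -> F) :
  \sum_(x : word k) \prod_(i < k) P i (x i) = \prod_(i < k) \sum_b P i b.
Proof. by rewrite bigA_distr_bigA. Qed.

(** Words of level [k.+1] are words of level [k] followed by a block; the last factor
is treated apart, as in [tau]. *)
Lemma sum_wordS k (P : 'I_k -> bits4 -> F) (Q : bits4 -> F) :
  \sum_(y : word k.+1) (\prod_(i < k) P i (init_word y i)) * Q (y ord_max) =
  (\prod_(i < k) \sum_b P i b) * \sum_b Q b.
Proof.
(* The only index of ['I_k.+1] without preimage in ['I_k] is the last one. *)
pose W (i : 'I_k.+1) b := if insub (i : nat) is Some j then P j b else Q b.
have Ww (i : 'I_k) b : W (widen_ord (leqnSn k) i) b = P i b by rewrite /W valK.
have Wm b : W ord_max b = Q b by rewrite /W insubF//= ltnn.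
transitivity (\prod_(i < k.+1) \sum_b W i b).
  rewrite bigA_distr_bigA; apply: eq_bigr => y _.
  rewrite big_ord_recr Wm; congr (_ * _).
  by apply: eq_bigr => i _; rewrite Ww ffunE.
rewrite big_ord_recr; congr (_ * _); last by apply: eq_bigr => b _; rewrite Wm.
by apply: eq_bigr => i _; apply: eq_bigr => b _; rewrite Ww.
Qed.

Lemma norm_prod_sgn k (f : 'I_k -> bool) : `|\prod_(i < k) sgn (f i)| = 1.
Proof. by rewrite normr_prod big1// => i _; rewrite norm_sgn. Qed.

Lemma norm_sigma k (x : word k) g : `|sigma x g| = 1.
Proof. exact: norm_prod_sgn. Qed.

Lemma norm_tau k (y : word k.+1) g : `|tau y g| = 1.
Proof. by rewrite /tau !normrM norm_prod_sgn !norm_sgn !mulr1. Qed.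

Lemma sqr_prod_sgn k (f : 'I_k -> bool) :
  (\prod_(i < k) sgn (f i)) * (\prod_(i < k) sgn (f i)) = 1.
Proof. by rewrite -big_split big1//= => i _; rewrite sgnK. Qed.

(** Summing over the linear forms alone already separates distinct words. *)
Lemma sum_dual_word k (x x' : word k) d d' : x != x' ->
  \sum_(a : word k) (\prod_(i < k) sgn (phase (a i) d (x i))) *
                    (\prod_(i < k) sgn (phase (a i) d' (x' i))) = 0.
Proof.
move=> xx'; under eq_bigr do rewrite -big_split /=.
rewrite (sum_word (fun i b => sgn (phase b d (x i)) * sgn (phase b d' (x' i)))).
have /existsP[i xi] : [exists i, x i != x' i].
  apply: contraR xx'; rewrite negb_exists => /forallP e.
  by apply/eqP/ffunP => i; apply/eqP; rewrite -[_ == _]negbK.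
by rewrite (bigD1 i)//= dual_char_sum (negbTE xi) mulr0 !mul0r.
Qed.

Lemma sum_point k (P : point k -> F) :
  \sum_g P g = \sum_c \sum_t \sum_a P (a, (c, t)).
Proof.
rewrite pair_bigA /= exchange_big /= pair_bigA /=.
by apply: eq_bigr => -[a [c t]].
Qed.

Lemma sigma_orth k (x x' : word k) :
  \sum_g sigma x g * sigma x' g = #|point k|%:R * (x == x')%:R.
Proof.
have [<-|xx'] := eqVneq x x'.
  under eq_bigr do rewrite sqr_prod_sgn.
  by rewrite sumr_const mulr1.
rewrite mulr0 sum_point big1// => c _; rewrite big1// => t _.
by rewrite /sigma /= sum_dual_word.
Qed.

(** If the linear parts of the two characters agree, their product depends on [t] only
through [sgn t], and the two values of [t] cancel. *)
Lemma sigma_tau_orth k (x : word k) (y : word k.+1) :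
  \sum_g sigma x g * tau y g = 0.
Proof.
rewrite sum_point big1// => c _.
have [xy|xy] := eqVneq x (init_word y); last first.
  rewrite big1// => t _; under eq_bigr do rewrite /sigma /tau mulrA /=.
  by rewrite -mulr_suml sum_dual_word// mul0r.
rewrite exchange_big big1// => a _; rewrite big_bool /sigma /tau /= -xy.
have e t : \prod_(i < k) sgn (phase (a i) (c, t, true) (x i)) *
   \prod_(i < k) sgn (phase (a i) (zero4, t, false) (x i)) =
   \prod_(i < k) sgn (quad (c, false, true) (x i)).
  rewrite -big_split; apply: eq_bigr => i _ /=; rewrite -sgnD -phaseD.
  have -> : xor4 (a i) (a i) = zero4 by apply/eqP; rewrite xor4_eq0.
  case: c => -[[c1 c2] c3] c4; rewrite /= !addbF addbb.
  by rewrite /phase; case: (x i) => -[[? ?] ?] ?.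
rewrite !mulrA !e -!mulrA -mulrDr -mulrDl.
by rewrite /sgn expr1 expr0 addNr mul0r mulr0.
Qed.

Lemma tau_orth k (y y' : word k.+1) :
  \sum_g tau y g * tau y' g = #|point k|%:R * (y == y')%:R.
Proof.
have [<-|yy'] := eqVneq y y'.
  under eq_bigr do rewrite /tau mulrACA sqr_prod_sgn mulrACA !sgnK !mulr1.
  by rewrite sumr_const mulr1.
rewrite mulr0 sum_point.
have [e|yi] := eqVneq (init_word y) (init_word y'); last first.
  rewrite big1// => c _; rewrite big1// => t _.
  under eq_bigr do rewrite /tau mulrACA /=.
  by rewrite -mulr_suml sum_dual_word// mul0r.
have ym : y ord_max != y' ord_max.
  by apply: contraNneq yy' => ym; apply/eqP/init_wordP.
rewrite exchange_big big1//= => t _; rewrite exchange_big big1//= => a _.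
under eq_bigr => c _.
  rewrite /tau e mulrACA sqr_prod_sgn mulrACA !sgnK !mul1r /=.
  rewrite dot4C (dot4C c) -!(phase0 _ _); over.
by rewrite char_sumM_eq (negbTE ym) mulr0.
Qed.

Lemma norm_prod_le k (f : 'I_k -> F) : (forall i, `|f i| <= 8) ->
  `|\prod_(i < k) f i| <= 8 ^+ k.
Proof.
move=> f8; rewrite normr_prod -[k in leRHS]card_ord -prodr_const.
by apply: ler_prod => i _; rewrite normr_ge0 f8.
Qed.

(** Blocks have 16 elements and contribute at most 8 each: one half per block. *)
Lemma avg_word_le k (v : F) : `|v| <= 8 ^+ k ->
  `|#|word k|%:R^-1 * v| <= (2 ^+ k)^-1.
Proof.
move=> v8; rewrite card_word natrX normrM normfV normrX normr_nat.
rewrite ler_pdivrMl ?exprn_gt0// (le_trans v8)//.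
rewrite (_ : 16%:R = 8 * 2 :> F); last by rewrite -natrM.
by rewrite exprMn mulfK// expf_neq0// pnatr_eq0.
Qed.

Lemma point_neq k (g h : point k) : g != h -> g.2 = h.2 ->
  exists i, g.1 i != h.1 i.
Proof.
move=> gh e; apply/existsP; apply: contraR gh; rewrite negb_exists => /forallP e'.
move: g h e e' => [a ?] [a' ?] /= -> e'; apply/eqP; congr (_, _).
by apply/ffunP => i; apply/eqP; rewrite -[_ == _]negbK.
Qed.

(** If the quadratic bits of [g] and [h] differ, every block is incoherent; otherwise
the linear forms differ in some block, whose sum vanishes. *)
Lemma sigma_coherence k (g h : point k) : g != h ->
  `|#|word k|%:R^-1 * \sum_x sigma x g * sigma x h| <= (2 ^+ k)^-1.
Proof.
move=> gh; apply: avg_word_le; under eq_bigr do rewrite -big_split /=.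
rewrite (sum_word (fun i b => sgn (phase (g.1 i) (g.2.1, g.2.2, true) b)
                            * sgn (phase (h.1 i) (h.2.1, h.2.2, true) b))).
have [e|gh2] := eqVneq g.2 h.2; last first.
  apply: norm_prod_le => i; apply: char_sumM_le; apply: contraNneq gh2.
  by move: (g.2) (h.2) => [? ?] [? ?] /= [-> ->].
have [i gi] := point_neq gh e.
by rewrite (bigD1 i)//= e char_sumM_eq (negbTE gi) mulr0 mul0r normr0 exprn_ge0.
Qed.

(** As for [sigma], except that the bits [c] appear only in the last block. *)
Lemma tau_coherence k (g h : point k) : g != h ->
  `|#|word k.+1|%:R^-1 * \sum_y tau y g * tau y h| <= (2 ^+ k)^-1.
Proof.
move=> gh; under eq_bigr do
  rewrite /tau mulrACA -big_split [X in _ * X]mulrACA mulrCA -!(phase0 _ _) /=.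
rewrite -mulr_sumr (sum_wordS
  (fun i b => sgn (phase (g.1 i) (zero4, g.2.2, false) b)
            * sgn (phase (h.1 i) (zero4, h.2.2, false) b))
  (fun b => sgn (phase g.2.1 zero6 b) * sgn (phase h.2.1 zero6 b))).
rewrite mulrA (char_sumM_eq _ g.2.1).
rewrite card_word expnS -(card_word k) natrM.
set v := (X in `|X|).
have -> : v = #|word k|%:R^-1 * ((g.2.1 == h.2.1)%:R * (sgn g.2.2 * sgn h.2.2 *
   \prod_i (\sum_b sgn (phase (g.1 i) (zero4, g.2.2, false) b)
            * sgn (phase (h.1 i) (zero4, h.2.2, false) b)))).
  rewrite /v; set p := \prod_(i < k) _; field.
  by rewrite pnatr_eq0 card_word expn_eq0.
have [e1|] := eqVneq g.2.1 h.2.1; last first.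
  by rewrite mul0r mulr0 normr0 invr_ge0 exprn_ge0.
apply: avg_word_le; rewrite mul1r !normrM !norm_sgn !mul1r.
have [e2|e2] := eqVneq g.2.2 h.2.2; last first.
  by apply: norm_prod_le => i; apply: char_sumM_le; rewrite !xpair_eqE (negbTE e2).
have [|i gi] := point_neq gh.
  by move: (g.2) (h.2) e1 e2 => [? ?] [? ?] /= -> ->.
by rewrite (bigD1 i)//= e2 char_sumM_eq (negbTE gi) mulr0 mul0r normr0 exprn_ge0.
Qed.

(** On the diagonal both averages are 1 and cancel, which is why only their difference
is small for all pairs of points. *)
Lemma tau_sub_sigma_coherence k (g h : point k) :
  `|#|word k.+1|%:R^-1 * (\sum_y tau y g * tau y h)
    - #|word k|%:R^-1 * \sum_x sigma x g * sigma x h| <= 2 * (2 ^+ k)^-1.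
Proof.
have [<-|gh] := eqVneq g h; last first.
  rewrite mulr_natl mulr2n (le_trans (ler_normB _ _))// lerD//.
    exact: tau_coherence.
  exact: sigma_coherence.
under eq_bigr do rewrite /tau mulrACA sqr_prod_sgn mulrACA !sgnK !mulr1.
under [X in _ - _ * X]eq_bigr do rewrite sqr_prod_sgn.
rewrite !sumr_const !mulVf ?subrr ?normr0 ?mulr_ge0 ?invr_ge0 ?exprn_ge0//.
  by rewrite pnatr_eq0 card_word expn_eq0.
by rewrite pnatr_eq0 card_word expn_eq0.
Qed.

(** Only [sigma] contains the sixth monomial, so that every block, the last one
included, has a nonzero quadratic part for all choices of points. *)
Lemma tau_sigma_coherence k (g : point k) (h : point k.+1) :
  `|#|word k.+1|%:R^-1 * \sum_y tau y g * sigma y h| <= (2 ^+ k.+1)^-1.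
Proof.
apply: avg_word_le.
pose P (i : 'I_k) b := sgn (phase (g.1 i) (zero4, g.2.2, false) b) *
  sgn (phase (h.1 (widen_ord (leqnSn k) i)) (h.2.1, h.2.2, true) b).
pose Q b := sgn (phase g.2.1 zero6 b) * sgn (phase (h.1 ord_max) (h.2.1, h.2.2, true) b).
have -> : \sum_y tau y g * sigma y h =
    sgn g.2.2 * \sum_(y : word k.+1) (\prod_(i < k) P i (init_word y i)) * Q (y ord_max).
  rewrite mulr_sumr; apply: eq_bigr => y _.
  rewrite /tau /sigma big_ord_recr /= mulrACA -big_split /= [RHS]mulrCA.
  congr (_ * _); last by rewrite /Q phase0 mulrA.
  by apply: eq_bigr => i _; rewrite /P ffunE.
rewrite sum_wordS exprSr !normrM norm_sgn mul1r ler_pM//.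
  by apply: norm_prod_le => i; apply: char_sumM_le; rewrite !xpair_eqE !andbF.
by apply: char_sumM_le; rewrite !xpair_eqE !andbF.
Qed.
End system.

(** * Limits of complex sequences *)

Section complex_limits.
Variable R : realType.
Local Notation C := R[i].
Local Notation normc := (@Normc.normc R).
Local Notation Re := (@complex.Re R).
Local Notation Im := (@complex.Im R).

Lemma normcE (z : C) : `|z| = (normc z)%:C. Proof. by []. Qed.

Lemma normc_ge0 (z : C) : 0 <= normc z.
Proof. by rewrite -ler0c -normcE. Qed.

Lemma normcD (x y : C) : normc (x + y) <= normc x + normc y.
Proof. exact: le_normcD. Qed.

Lemma normcB (x y : C) : normc (x - y) = normc (y - x).
Proof. by apply: complexI; rewrite -!normcE distrC. Qed.

Lemma normc_triangle (y x z : C) : normc (x - z) <= normc (x - y) + normc (y - z).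
Proof. by rewrite -[x - z](subrKA y) normcD. Qed.

Lemma normc_sum (I : Type) (r : seq I) (P : pred I) (f : I -> C) :
  normc (\sum_(i <- r | P i) f i) <= \sum_(i <- r | P i) normc (f i).
Proof.
elim/big_ind2: _ => //; first by rewrite Normc.normc0.
by move=> x1 x2 y1 y2 h1 h2; rewrite (le_trans (normcD _ _))// lerD.
Qed.

Lemma Re_le_normc (z : C) : `|Re z| <= normc z.
Proof. by case: z => a b /=; rewrite -sqrtr_sqr ler_wsqrtr// lerDl sqr_ge0. Qed.

Lemma Im_le_normc (z : C) : `|Im z| <= normc z.
Proof. by case: z => a b /=; rewrite -sqrtr_sqr ler_wsqrtr// lerDr sqr_ge0. Qed.

Lemma normc_le_ReIm (z : C) : normc z <= `|Re z| + `|Im z|.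
Proof.
case: z => a b /=; rewrite -[leRHS]ger0_norm ?addr_ge0// -sqrtr_sqr ler_wsqrtr//.
by rewrite sqrrD !real_normK ?num_real// lerD2r lerDl mulrn_wge0// mulr_ge0.
Qed.

Lemma normc_gt0 (t : R) : 0 < t -> normc t%:C = t.
Proof. by move=> t0; rewrite /= expr0n/= addr0 sqrtr_sqr gtr0_norm. Qed.

(** Completeness in quantitative form: the modulus passes to the limit. *)
Lemma complex_cauchy_limit (s : nat -> C) (e : nat -> R) : e n @[n --> \oo] --> 0 ->
  (forall m n, (m <= n)%N -> normc (s m - s n) <= e m) ->
  exists l, forall m, normc (s m - l) <= e m.
Proof.
move=> e0 se.
have lim (P : C -> R) : (forall x y, P (x - y) = P x - P y) ->
    (forall z, `|P z| <= normc z) -> P (s n) @[n --> \oo] --> limn (P \o s).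
  move=> PB PN; apply/cauchy_cvgP/cauchyP => _/posnumP[d] /=.
  have /cvgrPdist_lt/(_ _ (gt0 d)) [m _ me] := e0.
  exists (P (s m)); exists m => // n /= mn.
  rewrite /ball /= -PB (le_lt_trans (PN _))// (le_lt_trans (se _ _ mn))//.
  by have := me m (leqnn m); rewrite sub0r normrN; apply: le_lt_trans; rewrite ler_norm.
have ReB x y : Re (x - y) = Re x - Re y by case: x; case: y.
have ImB x y : Im (x - y) = Im x - Im y by case: x; case: y.
have cR := lim Re ReB Re_le_normc; have cI := lim Im ImB Im_le_normc.
exists (limn (Re \o s) +i* limn (Im \o s)) => m; apply/ler_addgt0Pr => _/posnumP[d].
have d2 : 0 < d%:num / 2 by [].
have /cvgrPdist_le/(_ _ d2) [p1 _ h1] := cR.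
have /cvgrPdist_le/(_ _ d2) [p2 _ h2] := cI.
pose n := maxn m (maxn p1 p2).
rewrite (le_trans (normc_triangle (s n) _ _))// lerD//; first by rewrite se// leq_maxl.
rewrite (le_trans (normc_le_ReIm _))// ReB ImB /= [leRHS]splitr.
by rewrite lerD// distrC ?h1 ?h2//= /n !leq_max leqnn ?orbT.
Qed.
End complex_limits.

(** * The sequence space *)

Local Notation normc := Normc.normc.

Section davie_space.
Variable R : realType.
Local Notation C := R[i].

Definition index := {k : nat & word k}.
Definition at_word k (x : word k) : index := existT (fun k => word k : Type) k x.

Implicit Types a b : index -> C.

Definition ev a k (g : point k) : C :=
  \sum_(x : word k) a (at_word x) * sigma C x g +
  \sum_(y : word k.+1) a (at_word y) * tau C y g.

Lemma evD a b k (g : point k) : ev (a + b) g = ev a g + ev b g.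
Proof.
rewrite /ev addrACA -!big_split.
by congr (_ + _); apply: eq_bigr => x _; rewrite /= -mulrDl.
Qed.

Lemma evZ c a k (g : point k) : ev (c *: a) g = c * ev a g.
Proof.
rewrite /ev mulrDr !mulr_sumr.
by congr (_ + _); apply: eq_bigr => x _; rewrite [RHS]mulrA.
Qed.

Lemma evN a k (g : point k) : ev (- a) g = - ev a g.
Proof. by rewrite -scaleN1r evZ mulN1r. Qed.

Lemma evB a b k (g : point k) : ev (a - b) g = ev a g - ev b g.
Proof. by rewrite evD evN. Qed.

Lemma card_point_neq0 k : #|point k|%:R != 0 :> C.
Proof.
by rewrite pnatr_eq0 !card_prod card_ffun !card_prod card_bool !muln_eq0 expn_eq0.
Qed.

(** Orthogonality of [sigma_x] to all other sign functions on the points of level [k]. *)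
Lemma coef_ev a k (x : word k) :
  a (at_word x) = #|point k|%:R^-1 * \sum_g sigma C x g * ev a g.
Proof.
have -> : \sum_g sigma C x g * ev a g = #|point k|%:R * a (at_word x).
  under eq_bigr do rewrite /ev mulrDr !mulr_sumr.
  rewrite big_split /= exchange_big /= [X in _ + X]exchange_big /=.
  rewrite [X in _ + X]big1 ?addr0 => [|y _]; last first.
    under eq_bigr do rewrite mulrCA.
    by rewrite -mulr_sumr sigma_tau_orth mulr0.
  rewrite (bigD1 x)//= [X in _ + X]big1 ?addr0 => [|x' x'x].
    under eq_bigr do rewrite mulrCA.
    by rewrite -mulr_sumr sigma_orth eqxx mulr1 mulrC.
  under eq_bigr do rewrite mulrCA.
  by rewrite -mulr_sumr sigma_orth eq_sym (negbTE x'x) !mulr0.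
by rewrite mulKf// card_point_neq0.
Qed.

(** The same coordinate, read one level below through [tau]. *)
Lemma coef_ev_tau a k (y : word k.+1) :
  a (at_word y) = #|point k|%:R^-1 * \sum_g tau C y g * ev a g.
Proof.
have -> : \sum_g tau C y g * ev a g = #|point k|%:R * a (at_word y).
  under eq_bigr do rewrite /ev mulrDr !mulr_sumr.
  rewrite big_split /= exchange_big /= [X in _ + X]exchange_big /=.
  rewrite big1 ?add0r => [|x _]; last first.
    under eq_bigr do rewrite mulrCA [tau _ _ _ * _]mulrC.
    by rewrite -mulr_sumr sigma_tau_orth mulr0.
  rewrite (bigD1 y)//= [X in _ + X]big1 ?addr0 => [|y' y'y].
    under eq_bigr do rewrite mulrCA.
    by rewrite -mulr_sumr tau_orth eqxx mulr1 mulrC.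
  under eq_bigr do rewrite mulrCA.
  by rewrite -mulr_sumr tau_orth eq_sym (negbTE y'y) !mulr0.
by rewrite mulKf// card_point_neq0.
Qed.

Lemma normc_sigma k (x : word k) g : normc (sigma C x g) = 1.
Proof. by apply: complexI; rewrite -normcE norm_sigma. Qed.

Lemma normc_tau k (x : word k.+1) g : normc (tau C x g) = 1.
Proof. by apply: complexI; rewrite -normcE norm_tau. Qed.

Lemma normc_nat n : normc (n%:R : C) = n%:R.
Proof. by apply: complexI; rewrite -normcE normr_nat rmorph_nat. Qed.

Lemma normc_avg_le k (u : point k -> C) M : (forall g, normc (u g) <= M) ->
  normc (#|point k|%:R^-1 * \sum_g u g) <= M.
Proof.
move=> uM; rewrite Normc.normcM Normc.normcV normc_nat.
have p0 : 0 < #|point k|%:R :> R.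
  by rewrite ltr0n lt0n; have := card_point_neq0 k; rewrite pnatr_eq0.
rewrite ler_pdivrMl// (le_trans (normc_sum _ _ _))// mulr_natl -sumr_const.
by apply: ler_sum => g _.
Qed.

Lemma coef_le a M k (x : word k) : (forall k (g : point k), normc (ev a g) <= M) ->
  normc (a (at_word x)) <= M.
Proof.
move=> aM; rewrite coef_ev; apply: normc_avg_le => g.
by rewrite Normc.normcM normc_sigma mul1r.
Qed.

(** Each value involves finitely many coordinates: coordinatewise convergence implies
convergence of each value. *)
Lemma ev_le_coefs a k (g : point k) :
  normc (ev a g) <= \sum_(x : word k) normc (a (at_word x)) +
                    \sum_(y : word k.+1) normc (a (at_word y)).
Proof.
rewrite (le_trans (normcD _ _))// lerD// (le_trans (normc_sum _ _ _))//;
  apply: ler_sum => x _; rewrite Normc.normcM.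
  by rewrite normc_sigma mulr1.
by rewrite normc_tau mulr1.
Qed.

Definition fin_supp a := exists N, forall k (x : word k), (N <= k)%N -> a (at_word x) = 0.

(** The closure of the finitely supported sequences for the supremum of the values. *)
Definition davie_approximable a := forall e : R, 0 < e ->
  exists2 b, fin_supp b & forall k (g : point k), normc (ev (a - b) g) <= e.

Lemma fin_supp_bounded b : fin_supp b ->
  exists M, forall k (g : point k), normc (ev b g) <= M.
Proof.
move=> [N bN]; pose S k := \sum_(x : word k) normc (b (at_word x)) +
   \sum_(y : word k.+1) normc (b (at_word y)).
have S0 k : 0 <= S k by rewrite addr_ge0// sumr_ge0// => i _; exact: normc_ge0.
exists (\sum_(k < N) S k) => k g.
have [kN|Nk] := ltnP k N.
  rewrite (le_trans (ev_le_coefs _ _))// (bigD1 (Ordinal kN))//= lerDl.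
  by rewrite sumr_ge0.
rewrite (_ : ev b g = 0) ?Normc.normc0 ?sumr_ge0//.
by rewrite /ev big1 ?add0r => [|x _]; rewrite ?big1// => *; rewrite bN ?mul0r// leqW.
Qed.

Lemma approximable_bounded a : davie_approximable a ->
  exists M, forall k (g : point k), normc (ev a g) <= M.
Proof.
move=> /(_ 1 ltr01)[b /fin_supp_bounded[M bM] ab]; exists (1 + M) => k g.
by rewrite -[a](subrK b) evD (le_trans (normcD _ _))// lerD.
Qed.

Lemma fin_supp_approximable b : fin_supp b -> davie_approximable b.
Proof.
move=> fb e e0; exists b => // k g.
by rewrite subrr -(scale0r b) evZ mul0r Normc.normc0 ltW.
Qed.

Lemma fin_suppD a b : fin_supp a -> fin_supp b -> fin_supp (a + b).
Proof.
move=> [N aN] [M bM]; exists (maxn N M) => k x; rewrite geq_max => /andP[Nk Mk].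
have -> : (a + b) (at_word x) = a (at_word x) + b (at_word x) by [].
by rewrite aN// bM// addr0.
Qed.

Lemma fin_suppZ c a : fin_supp a -> fin_supp (c *: a).
Proof.
move=> [N aN]; exists N => k x Nk.
have -> : (c *: a) (at_word x) = c * a (at_word x) by [].
by rewrite aN// mulr0.
Qed.

Definition davie_pred : {pred index -> C} := fun a => `[< davie_approximable a >].

Lemma davie_predP a : reflect (davie_approximable a) (a \in davie_pred).
Proof. exact: asboolP. Qed.

Lemma davie_submod_closed : submod_closed davie_pred.
Proof.
split.
  by apply/davie_predP/fin_supp_approximable; exists 0%N.
move=> c a b /davie_predP ha /davie_predP hb; apply/davie_predP => e e0.
have e2 : 0 < e / 2 by rewrite divr_gt0.
have c0 : 0 < normc c + 1 by rewrite ltr_wpDl// normc_ge0.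
have [a' fa aa'] := ha (e / 2 / (normc c + 1)) (divr_gt0 e2 c0).
have [b' fb bb'] := hb _ e2.
exists (c *: a' + b') => [|k g]; first exact/fin_suppD/fb/fin_suppZ.
rewrite opprD addrACA -scalerBr evD (le_trans (normcD _ _))// [leRHS]splitr lerD//.
rewrite evZ Normc.normcM (le_trans (ler_wpM2l (normc_ge0 _) (aa' _ _)))//.
by rewrite mulrCA ger_pMr// ler_pdivrMr// mul1r lerDl.
Qed.
HB.instance Definition _ :=
  GRing.isSubmodClosed.Build C (index -> C) davie_pred davie_submod_closed.

Record davie := Davie { dseq :> index -> C ; _ : dseq \in davie_pred }.
HB.instance Definition _ := [isSub for dseq].
HB.instance Definition _ := [Choice of davie by <:].
HB.instance Definition _ := [SubChoice_isSubLmodule of davie by <:].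

End davie_space.

(** * The norm and completeness *)

Section davie_norm.
Variable R : realType.
Local Notation C := R[i].
Implicit Types f h : davie R.

Definition dnorm f : R := sup [set r | exists k (g : point k), r = normc (ev f g)].

Lemma davieP f : davie_approximable f.
Proof. by case: f => a /= /davie_predP. Qed.

Definition point0 k : point k := ([ffun=> zero4], (zero4, false)).

Lemma ev_le_dnorm f k (g : point k) : normc (ev f g) <= dnorm f.
Proof.
have [M fM] := approximable_bounded (davieP f).
apply: ub_le_sup; last by exists k, g.
by exists M => _ [k' [g' ->]].
Qed.

Lemma dnorm_le f M : (forall k (g : point k), normc (ev f g) <= M) -> dnorm f <= M.
Proof.
move=> fM; apply: ge_sup; last by move=> _ [k [g ->]].
by exists (normc (ev f (point0 0))), 0%N, (point0 0).
Qed.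

Lemma coef_le_dnorm f k (x : word k) : normc (f (at_word x)) <= dnorm f.
Proof. by apply: coef_le => *; exact: ev_le_dnorm. Qed.

Lemma dnorm_ge0 f : 0 <= dnorm f.
Proof. exact: le_trans (normc_ge0 _) (ev_le_dnorm f (point0 0)). Qed.

Lemma dnormD f h : dnorm (f + h) <= dnorm f + dnorm h.
Proof.
apply: dnorm_le => k g; rewrite [ev _ _]evD.
by rewrite (le_trans (normcD _ _))// lerD// ev_le_dnorm.
Qed.

(** The norm separates points because it controls the coordinates. *)
Lemma dnorm_eq0 f : dnorm f = 0 -> f = 0.
Proof.
move=> f0; apply/val_inj/funext => -[k x]; apply: Normc.eq0_normc.
by apply/eqP; rewrite eq_le normc_ge0 andbT -f0 coef_le_dnorm.
Qed.

Lemma dnormZ c f : dnorm (c *: f) = normc c * dnorm f.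
Proof.
have le c' f' : dnorm (c' *: f') <= normc c' * dnorm f'.
  apply: dnorm_le => k g; rewrite [ev _ _]evZ Normc.normcM.
  by rewrite ler_wpM2l ?normc_ge0// ev_le_dnorm.
have [->|c0] := eqVneq c 0.
  rewrite scale0r Normc.normc0 mul0r; apply/eqP; rewrite eq_le dnorm_ge0 andbT.
  by have := le 0 0; rewrite scale0r Normc.normc0 mul0r.
apply/eqP; rewrite eq_le le /=.
have nc0 : 0 < normc c.
  by rewrite lt_def normc_ge0 andbT; apply: contraNneq c0 => /Normc.eq0_normc ->.
by rewrite -ler_pdivlMl// -Normc.normcV -[in leLHS](scalerK c0 f) le.
Qed.

Lemma dnorm0 : dnorm (0 : davie R) = 0.
Proof. by rewrite -(scale0r 0) dnormZ Normc.normc0 mul0r. Qed.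

Definition dnormC f : C := (dnorm f)%:C.

Lemma dnormCD f h : dnormC (f + h) <= dnormC f + dnormC h.
Proof. by rewrite -rmorphD lecR dnormD. Qed.

Lemma dnormCZ c f : dnormC (c *: f) = `|c| * dnormC f.
Proof. by rewrite normcE -rmorphM; congr (_%:C); exact: dnormZ. Qed.

Lemma dnormC_eq0 f : dnormC f = 0 -> f = 0.
Proof. by move=> /complexI; exact: dnorm_eq0. Qed.

HB.instance Definition _ :=
  Lmodule_isNormed.Build C (davie R) dnormCD dnormCZ dnormC_eq0.

Lemma davie_normE f : `|f| = (dnorm f)%:C. Proof. by []. Qed.

Lemma gt0_complexP (e : C) : 0 < e -> exists2 r : R, 0 < r & e = r%:C.
Proof.
by case: e => a b; rewrite ltcE /= => /andP[/eqP -> a0]; exists a.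
Qed.

Lemma ball_davieE f h (r : R) : ball f r%:C h = (dnorm (f - h) < r).
Proof. by rewrite -ball_normE /ball_ /= davie_normE ltcR. Qed.

Lemma cvg_div_exp2 (r : R) : r / 2 ^+ n @[n --> \oo] --> (0 : R).
Proof.
under eq_fun do rewrite -exprVn.
have h2 : `|(2^-1 : R)| < 1 by rewrite ger0_norm ?invf_lt1 ?ltr1n.
by have := cvgM (cvg_cst r) (cvg_expr h2); rewrite mulr0; apply.
Qed.

(** The limit is taken coordinatewise. A value of [u m - l] is compared with the one of
[u m - u n], which is uniformly small; the error is a value of [u n - l], hence
vanishes as [n] grows. Such a limit is approximable since the [u m] are. *)
Lemma davie_cauchy_limit (u : nat -> davie R) (e : nat -> R) : e n @[n --> \oo] --> 0 ->
  (forall m n, (m <= n)%N -> dnorm (u m - u n) <= e m) ->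
  exists l, forall m, dnorm (u m - l) <= e m.
Proof.
move=> e0 ue.
have coef_lim i : exists l, forall m, normc (u m i - l) <= e m.
  apply: (complex_cauchy_limit e0) => m n mn; apply: le_trans (ue m n mn).
  by case: i => k x; exact: (coef_le_dnorm (u m - u n)).
have {coef_lim}[l ul] := choice coef_lim.
have evl m k (g : point k) : normc (ev (dseq (u m) - l) g) <= e m.
  pose c := (#|word k| + #|word k.+1|)%:R : R.
  have evn n : normc (ev (dseq (u n) - l) g) <= c * e n.
    rewrite (le_trans (ev_le_coefs _ _))// /c natrD mulrDl !mulr_natl -!sumr_const.
    by apply: lerD; apply: ler_sum => x _; exact: ul.
  apply/ler_addgt0Pr => d d0.
  have ce0 : c * e n @[n --> \oo] --> 0 by have := cvgM (cvg_cst c) e0; rewrite mulr0; apply.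
  have /cvgrPdist_le/(_ _ d0)[p _ hp] := ce0.
  pose n := maxn m p.
  have -> : dseq (u m) - l = dseq (u m - u n) + (dseq (u n) - l).
    by rewrite [dseq (u m - u n)]/(dseq (u m) - dseq (u n)) addrA subrK.
  rewrite evD (le_trans (normcD _ _))// lerD//.
    by rewrite (le_trans (ev_le_dnorm _ _))// ue// leq_maxl.
  rewrite (le_trans (evn n))//.
  by have := hp n (leq_maxr _ _); rewrite sub0r normrN; apply: le_trans; rewrite ler_norm.
have l_davie : l \in @davie_pred R.
  apply/davie_predP => d d0; have d2 : 0 < d / 2 by rewrite divr_gt0.
  have /cvgrPdist_le/(_ _ d2)[m _ /(_ m (leqnn m))] := e0.
  rewrite sub0r normrN => em.
  have [b fb ub] := davieP (u m) d2; exists b => // k g.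
  have -> : l - b = (dseq (u m) - b) - (dseq (u m) - l).
    by rewrite opprB [RHS]addrC subrKA.
  rewrite evB (le_trans (normcD _ _))// [leRHS]splitr lerD ?ub//.
  by rewrite normcN (le_trans (evl _ _ _))// (le_trans _ em)// ler_norm.
by exists (Davie l_davie) => m; apply: dnorm_le => k g; exact: evl.
Qed.

(** A Cauchy filter is followed along centers of balls of radius [2^-n] that it
contains. *)
Lemma davie_complete (F : set_system (davie R)) : ProperFilter F -> cauchy F -> cvg F.
Proof.
move=> FF /cauchyP Fc; apply/cvg_ex.
have e_gt0 n : 0 < ((2 ^+ n)^-1 : R)%:C by rewrite ltcR invr_gt0 exprn_gt0.
have {Fc}/choice[u Fu] n := Fc _ (e_gt0 n).
have uu m n : (m <= n)%N -> dnorm (u m - u n) <= (1 + 1) / 2 ^+ m.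
  move=> mn; have [y []] := filter_ex (filterI (Fu m) (Fu n)).
  rewrite !ball_davieE => h1 h2.
  rewrite mulrDl !mul1r -(subrKA y) (le_trans (dnormD _ _))// lerD//.
    exact: ltW.
  rewrite -opprB -[- _]scaleN1r dnormZ normcN Normc.normc1 mul1r.
  by rewrite (le_trans (ltW h2))// lef_pV2 ?posrE ?exprn_gt0// ler_weXn2l// ler1n.
have [l ul] := davie_cauchy_limit (cvg_div_exp2 (1 + 1)) uu.
exists l; apply/cvg_ballP => _/gt0_complexP[r r0 ->].
have /cvgrPdist_lt/(_ _ r0)[m _ /(_ m (leqnn m))] := cvg_div_exp2 (1 + 1 + 1).
rewrite sub0r normrN => /(le_lt_trans (ler_norm _)) mr.
apply: filterS (Fu m) => y; rewrite !ball_davieE => uy; apply: le_lt_trans mr.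
rewrite -(subrKA (u m)) (le_trans (dnormD _ _))// mulrDl lerD//.
  by rewrite -opprB -[- _]scaleN1r dnormZ normcN Normc.normc1 mul1r.
by rewrite mul1r ltW.
Qed.

HB.instance Definition _ := Uniform_isComplete.Build (davie R) davie_complete.
End davie_norm.

(** * Power series with bounded coefficients *)

Section power_series.
Variable R : realType.
Local Notation C := R[i].
Implicit Types (a b : nat -> C) (z w v : C) (D K : R).

Definition psum a z n := \sum_(i < n) a i * z ^+ i.

(** In the disk, and for bounded coefficients, convergence of the partial sums is
automatically geometric; taking the rate as the definition turns identities
between sums into estimates of partial sums. *)
Definition has_psum a z v :=
  exists K, forall n, normc (v - psum a z n) <= K * normc z ^+ n.

Definition power_sum a z : C := xget 0 [set v | has_psum a z v].

Definition coef_bounded a D := forall n, normc (a n) <= D.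

Lemma normcX z n : normc (z ^+ n) = normc z ^+ n.
Proof. by elim: n => [|n IH]; rewrite ?Normc.normc1// !exprS Normc.normcM IH. Qed.

Lemma cvg_geometric_bound K z : normc z < 1 -> K * normc z ^+ n @[n --> \oo] --> (0 : R).
Proof.
move=> z1; have z1' : `|normc z| < 1 by rewrite ger0_norm// normc_ge0.
by have := cvgM (cvg_cst K) (cvg_expr z1'); rewrite mulr0; apply.
Qed.

Lemma has_psum_unique a z v w : normc z < 1 ->
  has_psum a z v -> has_psum a z w -> v = w.
Proof.
move=> z1 [K vK] [K' wK']; apply/eqP; rewrite -subr_eq0; apply/eqP/Normc.eq0_normc.
apply/eqP; rewrite eq_le normc_ge0 andbT; apply/ler_addgt0Pr => e e0.
have /cvgrPdist_le/(_ _ e0)[n _ /(_ n (leqnn n))] := cvg_geometric_bound (K + K') z1.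
rewrite sub0r normrN add0r; apply: le_trans; apply: le_trans (ler_norm _).
rewrite (le_trans (normc_triangle (psum a z n) _ _))// mulrDl lerD//.
by rewrite normcB.
Qed.

Lemma psum_tail a D z m n : coef_bounded a D -> normc z < 1 -> (m <= n)%N ->
  normc (psum a z m - psum a z n) <= D / (1 - normc z) * normc z ^+ m.
Proof.
move=> aD z1 mn; have z0 := normc_ge0 z; have D0 := le_trans (normc_ge0 _) (aD 0).
have z1' : 0 < 1 - normc z by rewrite subr_gt0.
suff: normc (psum a z m - psum a z n) <= D / (1 - normc z) * (normc z ^+ m - normc z ^+ n).
  move/le_trans; apply; rewrite ler_wpM2l//; first by rewrite divr_ge0// ltW.
  by rewrite gerBl exprn_ge0.
elim: n mn => [|n IH]; first by rewrite leqn0 => /eqP ->; rewrite !subrr Normc.normc0 mulr0.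
rewrite leq_eqVlt => /orP[/eqP ->|]; first by rewrite !subrr Normc.normc0 mulr0.
rewrite ltnS => /IH {}IH; rewrite (le_trans (normc_triangle (psum a z n) _ _))//.
have -> : D / (1 - normc z) * (normc z ^+ m - normc z ^+ n.+1) =
  D / (1 - normc z) * (normc z ^+ m - normc z ^+ n) + D * normc z ^+ n.
  by rewrite exprS; field; rewrite gt_eqF.
rewrite lerD// normcB /psum big_ord_recr /= addrAC subrr add0r Normc.normcM normcX.
by rewrite ler_wpM2r ?exprn_ge0.
Qed.

Lemma power_sum_rate a D z n : coef_bounded a D -> normc z < 1 ->
  normc (power_sum a z - psum a z n) <= D / (1 - normc z) * normc z ^+ n.
Proof.
move=> aD z1; have [l al] := complex_cauchy_limit (cvg_geometric_bound (D / (1 - normc z)) z1)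
  (fun m n => @psum_tail a D z m n aD z1).
have hl : has_psum a z l by exists (D / (1 - normc z)) => m; rewrite normcB.
have hp : has_psum a z (power_sum a z) by apply: (@xgetPex _ 0 [set v | has_psum a z v]); exists l.
by rewrite -(has_psum_unique z1 hl hp) normcB.
Qed.

Lemma power_sumP a D z : coef_bounded a D -> normc z < 1 -> has_psum a z (power_sum a z).
Proof. by move=> aD z1; exists (D / (1 - normc z)) => n; exact: power_sum_rate. Qed.

Lemma power_sum_le a D z : coef_bounded a D -> normc z < 1 ->
  normc (power_sum a z) <= D / (1 - normc z).
Proof.
move=> aD z1; have := power_sum_rate 0 aD z1.
by rewrite /psum big_ord0 subr0 expr0 mulr1.
Qed.

Lemma power_sumE a D z v : coef_bounded a D -> normc z < 1 -> has_psum a z v ->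
  power_sum a z = v.
Proof. by move=> aD z1; apply: has_psum_unique => //; exact: power_sumP aD z1. Qed.

Lemma power_sum_linear c a b D D' z : coef_bounded a D -> coef_bounded b D' -> normc z < 1 ->
  power_sum (fun n => c * a n + b n) z = c * power_sum a z + power_sum b z.
Proof.
move=> aD bD z1; apply: (@power_sumE _ (normc c * D + D')) => //.
  by move=> n; rewrite (le_trans (normcD _ _))// lerD// Normc.normcM ler_wpM2l// normc_ge0.
exists (normc c * (D / (1 - normc z)) + D' / (1 - normc z)) => n.
have -> : psum (fun n => c * a n + b n) z n = c * psum a z n + psum b z n.
  rewrite /psum mulr_sumr -big_split; apply: eq_bigr => i _.
  by rewrite mulrDl mulrA.
rewrite opprD addrACA -mulrBr (le_trans (normcD _ _))// mulrDl lerD//.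
  by rewrite Normc.normcM -mulrA ler_wpM2l ?normc_ge0// power_sum_rate.
by rewrite power_sum_rate.
Qed.

Lemma power_sum_fin a N z : (forall n, (N <= n)%N -> a n = 0) -> normc z < 1 ->
  power_sum a z = psum a z N.
Proof.
move=> aN z1; pose D := \sum_(i < N) normc (a i).
have aD : coef_bounded a D.
  move=> n; have [nN|/aN ->] := ltnP n N; last first.
    by rewrite Normc.normc0 sumr_ge0// => *; exact: normc_ge0.
  rewrite /D (bigD1 (Ordinal nN))//= lerDl sumr_ge0// => *; exact: normc_ge0.
apply/eqP; rewrite -subr_eq0; apply/eqP/Normc.eq0_normc/eqP.
rewrite eq_le normc_ge0 andbT; apply/ler_addgt0Pr => e e0.
have /cvgrPdist_le/(_ _ e0)[n _ nP] := cvg_geometric_bound (D / (1 - normc z)) z1.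
have := nP (N + n)%N (leq_addl _ _).
rewrite sub0r normrN add0r; apply: le_trans; apply: le_trans (ler_norm _).
have <- : psum a z (N + n) = psum a z N.
  rewrite /psum big_split_ord /= [X in _ + X]big1 ?addr0// => i _.
  by rewrite aN ?mul0r// leq_addr.
exact: power_sum_rate.
Qed.

(** The coefficients of the tail of the series after [m] terms, divided by the power
[m] of the variable. *)
Definition shift m a n := a (m + n)%N.

Lemma shift_bounded m a D : coef_bounded a D -> coef_bounded (shift m a) D.
Proof. by move=> aD n; exact: aD. Qed.

Lemma power_sum_shift m a D z : coef_bounded a D -> normc z < 1 ->
  power_sum (shift m a) z = a m + z * power_sum (shift m.+1 a) z.
Proof.
move=> aD z1; apply: (power_sumE (shift_bounded m aD) z1).
have [K sK] := power_sumP (shift_bounded m.+1 aD) z1.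
exists (Num.max K (normc (a m + z * power_sum (shift m.+1 a) z))) => -[|n].
  by rewrite /psum big_ord0 subr0 expr0 mulr1 le_max lexx orbT.
have -> : psum (shift m a) z n.+1 = a m + z * psum (shift m.+1 a) z n.
  rewrite /psum big_ord_recl expr0 mulr1 /shift addn0; congr (_ + _).
  by rewrite mulr_sumr; apply: eq_bigr => i _; rewrite /= addSnnS exprS mulrCA.
rewrite opprD addrACA subrr add0r -mulrBr Normc.normcM exprS mulrCA.
rewrite ler_wpM2l ?normc_ge0// (le_trans (sK n))// ler_wpM2r ?exprn_ge0 ?normc_ge0//.
by rewrite le_max lexx.
Qed.

(** The coefficients of the difference quotient of the series at [z]. *)
Definition quot_coef a z m := power_sum (shift m.+1 a) z.

Lemma quot_coef_bounded a D z : coef_bounded a D -> normc z < 1 ->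
  coef_bounded (quot_coef a z) (D / (1 - normc z)).
Proof. by move=> aD z1 n; apply: power_sum_le => //; exact: shift_bounded. Qed.

(** The difference quotient at [z] is itself a power series with bounded coefficients.
Continuity and complex differentiability of power series are both immediate
consequences. At finite order this is a telescoping sum, whose remainder is a
tail of the series at [z] times [w ^+ n]. *)
Lemma power_sumB a D z w : coef_bounded a D -> normc z < 1 -> normc w < 1 ->
  power_sum a w - power_sum a z = (w - z) * power_sum (quot_coef a z) w.
Proof.
move=> aD z1 w1; have qD := quot_coef_bounded aD z1.
have fin n : power_sum a z + (w - z) * psum (quot_coef a z) w n =
    psum a w n + power_sum (shift n a) z * w ^+ n.
  elim: n => [|n IH]; first by rewrite /psum !big_ord0 mulr0 addr0 add0r mulr1.
  rewrite /psum !big_ord_recr /= -!/(psum _ _ _) mulrDr addrA IH /quot_coef.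
  by rewrite (power_sum_shift n aD z1) exprS; ring.
rewrite (@power_sumE a D w (power_sum a z + (w - z) * power_sum (quot_coef a z) w))//.
  by rewrite addrC addKr.
have [K qK] := power_sumP qD w1.
exists (normc (w - z) * K + D / (1 - normc z)) => n.
have -> : psum a w n = power_sum a z + (w - z) * psum (quot_coef a z) w n -
  power_sum (shift n a) z * w ^+ n by rewrite fin addrK.
set G := power_sum (quot_coef a z) w; set P := psum (quot_coef a z) w n.
rewrite [X in normc X](_ : _ = (w - z) * (G - P) + power_sum (shift n a) z * w ^+ n); last by ring.
rewrite (le_trans (normcD _ _))// [leRHS]mulrDl lerD// Normc.normcM.
  by rewrite -mulrA ler_wpM2l ?normc_ge0 /G /P ?qK.
rewrite normcX ler_wpM2r ?exprn_ge0 ?normc_ge0//.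
by apply: power_sum_le => //; exact: shift_bounded.
Qed.
End power_series.

(** * Holomorphy and uniqueness of the coefficients *)

Section holomorphy.
Variable R : realType.
Local Notation C := R[i].
Implicit Types (a : nat -> C) (z w : C) (D : R).

Lemma disk0 : normc (0 : C) < 1. Proof. by rewrite Normc.normc0. Qed.

(** Away from 0 one divides by [z]. At 0 the value [a 1] of the quotient is, for every
small [z], minus [z] times a bounded quantity, hence is 0. *)
Lemma power_sum_shift0 a D : coef_bounded a D ->
  (forall z, normc z < 1 -> power_sum a z = 0) ->
  forall z, normc z < 1 -> power_sum (shift 1 a) z = 0.
Proof.
move=> aD a0; have rec m z := @power_sum_shift R m a D z aD.
have a00 : a 0 = 0.
  by have := rec 0 0 disk0; rewrite mul0r addr0 => <-; exact: (a0 0 disk0).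
have b0 z : normc z < 1 -> z != 0 -> power_sum (shift 1 a) z = 0.
  move=> z1 zN0; have := rec 0 z z1; rewrite a00 add0r.
  by rewrite [LHS](a0 z z1) => /esym/eqP; rewrite mulf_eq0 (negbTE zN0) => /eqP.
move=> z z1; have [->|/(b0 _ z1)//] := eqVneq z 0.
rewrite (rec 1 0 disk0) mul0r addr0; apply: Normc.eq0_normc.
have D0 : 0 <= D := le_trans (normc_ge0 _) (aD 0).
apply/eqP; rewrite eq_le normc_ge0 andbT; apply/ler_addgt0Pr => e e0.
(* With [t <= 1 / 2] the tail is at most [t * (D * 2)], and [D + 1] avoids a zero
   denominator. *)
pose t := Num.min (1 / 2) (e / ((D + 1) * 2)).
have t0 : 0 < t by rewrite lt_min !divr_gt0// mulr_gt0// ltr_wpDl.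
have t2 : t <= 1 / 2 by rewrite ge_min lexx.
have te : t * ((D + 1) * 2) <= e.
  by rewrite -ler_pdivlMr ?mulr_gt0 ?ltr_wpDl// ge_min lexx orbT.
have nt := normc_gt0 t0.
have t1 : normc t%:C < 1 by rewrite nt; lra.
have tN0 : t%:C != 0 by rewrite eq_complex /= gt_eqF.
have /esym/eqP := rec 1 _ t1; rewrite (b0 _ t1 tN0) addr_eq0 => /eqP ->.
rewrite normcN Normc.normcM nt add0r.
have := power_sum_le (shift_bounded 2 aD) t1; rewrite nt => h.
apply: le_trans te; rewrite ler_wpM2l ?(ltW t0)// (le_trans h)//.
by rewrite ler_pdivrMr; [nra|lra].
Qed.

Lemma power_sum_coef0 a D : coef_bounded a D ->
  (forall z, normc z < 1 -> power_sum a z = 0) -> forall n, a n = 0.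
Proof.
move=> aD a0 n; elim: n a aD a0 => [|n IH] a aD a0.
  have := power_sum_shift 0 aD disk0; rewrite mul0r addr0 => <-; exact: (a0 0 disk0).
by have := IH _ (shift_bounded 1 aD) (power_sum_shift0 aD a0).
Qed.

(** The difference quotient is the sum of a power series, which is continuous at [z] by
a second application of the same factorization. *)
Lemma power_sum_derivable a D (f : cplx R -> cplx R) (z : cplx R) : coef_bounded a D ->
  (forall w : C, normc w < 1 -> f w = power_sum a w) -> normc (z : C) < 1 ->
  derivable f z (1 : R[i]^o).
Proof.
move=> aD fa z1; have bD := quot_coef_bounded aD z1.
apply/cvg_ex; exists (power_sum (quot_coef a z) z).
have z1' : 0 < 1 - normc z by rewrite subr_gt0.
(* A bound of the second difference quotient at distance at least [(1 - |z|) / 2]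
   from the unit circle. *)
pose M := D / (1 - normc z) / (1 - normc z) / ((1 - normc z) / 2).
have D0 : 0 <= D := le_trans (normc_ge0 _) (aD 0).
have D1 : 0 <= D / (1 - normc z) / (1 - normc z) by rewrite !divr_ge0// ltW.
have M0 : 0 <= M by rewrite /M !divr_ge0// ltW.
apply/cvgrPdist_le => _/gt0_complexP[e e0 ->].
pose r := Num.min ((1 - normc z) / 2) (e / (M + 1)).
have r0 : 0 < r by rewrite lt_min !divr_gt0// ltr_wpDl.
apply/nbhs_ballP; exists r%:C; first by rewrite /= ltcR.
move=> h; rewrite -ball_normE /= sub0r normrN [`|h|]normcE ltcR => hr h0.
have [hr1 hr2] : normc h < (1 - normc z) / 2 /\ normc h < e / (M + 1).
  by move: hr; rewrite lt_min => /andP[].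
have w1 : normc (h + z : C) < 1 by rewrite (le_lt_trans (normcD _ _))//; lra.
have -> : h *: (1 : R[i]^o) + z = h + z by congr (_ + _); exact: mulr1.
rewrite !fa// (power_sumB aD z1 w1) addrK.
have -> : h^-1 *: (h * power_sum (quot_coef a z) (h + z)) = power_sum (quot_coef a z) (h + z).
  exact: mulKf.
rewrite [`|_|]normcE lecR normcB (power_sumB bD z1 w1) addrK Normc.normcM.
have := power_sum_le (quot_coef_bounded bD z1) w1 => hM.
rewrite (@le_trans _ _ (normc h * M))//.
  rewrite ler_wpM2l ?normc_ge0// (le_trans hM)// /M ler_wpM2l//.
  rewrite lef_pV2 ?posrE ?subr_gt0 ?divr_gt0//.
  by have := normcD h z; lra.
rewrite (@le_trans _ _ (e / (M + 1) * M))//; first by rewrite ler_wpM2r// ltW.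
by rewrite mulrAC ler_pdivrMr ?ltr_wpDl// ler_wpM2l ?(ltW e0)// lerDl.
Qed.
End holomorphy.

(** * The inclusion into the holomorphic functions *)

Lemma index_enum : exists (phi : nat -> index) (psi : index -> nat),
  cancel phi psi /\ cancel psi phi.
Proof.
pose w0 k : word k := [ffun=> zero4].
have inf : infinite_set [set: index].
  have inj : injective (fun k => at_word (w0 k)) by move=> k k' [].
  apply/infiniteP; rewrite -(card_le_eql (inj_card_eq (in2W inj))).
  exact: subset_card_le.
have /pcard_eqP/bijPex[f] := @eq_card_nat index setT (countableP _) inf.
by rewrite setTT_bijective => -[g fK gK]; exists g, f.
Qed.

Section inclusion.
Variable R : realType.
Local Notation C := R[i].
Variable phi : nat -> index.
Implicit Types (f : davie R) (z : cplx R).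

Definition taylor f : nat -> C := dseq f \o phi.

Lemma taylor_bounded f : coef_bounded (taylor f) (dnorm f).
Proof. by move=> n; rewrite /taylor /=; case: (phi n) => k x; exact: coef_le_dnorm. Qed.

(** The value 0 outside the disk makes the map linear on total functions. *)
Definition incl f : cplx R -> cplx R :=
  fun z => if normc (z : C) < 1 then power_sum (taylor f) z else 0.

Lemma unit_diskE z : unit_disk R z = (normc (z : C) < 1) :> Prop.
Proof. by rewrite /unit_disk /= [`|z|]normcE ltcR. Qed.

Lemma inclE f z : unit_disk R z -> incl f z = power_sum (taylor f) z.
Proof. by rewrite unit_diskE /incl => ->. Qed.

Lemma incl_linear : linear incl.
Proof.
move=> c f h; apply/funext => z.
have -> : (c *: incl f + incl h) z = c * incl f z + incl h z by [].
rewrite /incl; case: ifP => [z1|_]; last by rewrite mulr0 addr0.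
exact: power_sum_linear (taylor_bounded f) (taylor_bounded h) z1.
Qed.
HB.instance Definition _ :=
  GRing.isLinear.Build C (davie R) (cplx R -> cplx R) *:%R incl incl_linear.

Lemma incl_holomorphic f : holomorphic_on_disk (incl f).
Proof.
move=> z; rewrite unit_diskE => z1.
apply: (power_sum_derivable (taylor_bounded f)) => // w w1.
by rewrite inclE// unit_diskE.
Qed.

(** The coefficients are bounded by the norm: comparison with a geometric series. *)
Lemma incl_bound f (rho : R) z : rho < 1 -> normc (z : C) <= rho ->
  normc (incl f z : C) <= dnorm f / (1 - rho).
Proof.
move=> rho1 zrho; have z1 := le_lt_trans zrho rho1.
rewrite inclE ?unit_diskE// (le_trans (power_sum_le (taylor_bounded f) z1))//.
by rewrite ler_wpM2l ?dnorm_ge0// lef_pV2 ?posrE ?subr_gt0// lerD2l lerN2.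
Qed.

Lemma normc_continuous : continuous (fun z : cplx R => normc (z : C)).
Proof.
move=> z; have Fz : Filter (nbhs z) := nbhs_filter z.
apply/(@cvgrPdist_lt R R (cplx R) (nbhs z)) => e e0.
apply/nbhs_ballP; exists e%:C; first by rewrite /= ltcR.
move=> w; rewrite -ball_normE /= [`|_|]normcE ltcR; apply: le_lt_trans.
rewrite ler_norml; apply/andP; split.
  by rewrite lerNl opprB lerBlDr normcB -{1}[w](subrK z) normcD.
by rewrite lerBlDr -{1}[z](subrK w) normcD.
Qed.

Lemma compact_in_disk_radius (K : set (cplx R)) : compact_in_disk K ->
  exists2 rho : R, rho < 1 & forall z, K z -> normc (z : C) <= rho.
Proof.
move=> [cK Kd]; have [->|/set0P K0] := eqVneq K set0; first by exists 0.
have [|c cK' cmax] := compact_EVT_max K0 cK (f := fun z : cplx R => normc (z : C)).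
  exact/continuous_subspaceT/normc_continuous.
exists (normc (c : C)); last by move=> z /mem_set/cmax.
by have := Kd c (set_mem cK'); rewrite unit_diskE.
Qed.

Lemma incl_continuous : continuous (incl : davie R -> disk_fun R).
Proof.
move=> f; have Ff : Filter (incl @ nbhs f) by exact: fmap_filter.
apply/(@fam_cvgP _ _ (@compact_in_disk R) (incl @ nbhs f)).
move=> K /compact_in_disk_radius[rho rho1 Krho] P.
move=> /uniform_nbhs[E [+ EP]]; rewrite -entourage_ballE => -[_/= /gt0_complexP[e e0 ->] eE].
apply/nbhs_ballP; exists (e * (1 - rho))%:C; first by rewrite /= ltcR mulr_gt0// subr_gt0.
move=> h; rewrite ball_davieE => fh; apply: EP => z Kz; apply: eE.
rewrite /= -ball_normE /= [`|_|]normcE ltcR.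
have -> : incl f z - incl h z = incl (f - h) z by rewrite linearB.
by rewrite (le_lt_trans (incl_bound _ rho1 (Krho z Kz)))// ltr_pdivrMr ?subr_gt0.
Qed.

Hypothesis (psi : index -> nat) (phiK : cancel phi psi) (psiK : cancel psi phi).

Lemma incl_inj f h : eq_on_disk (incl f) (incl h) -> f = h.
Proof.
move=> fh; apply/eqP; rewrite -subr_eq0; apply/eqP/val_inj/funext => i.
rewrite -(psiK i); apply: (power_sum_coef0 (taylor_bounded (f - h))) => z z1.
have zd : unit_disk R z by rewrite unit_diskE.
rewrite -inclE// linearB.
have -> : (incl f - incl h) z = incl f z - incl h z by [].
by rewrite (fh z zd) subrr.
Qed.

Definition davie_hol : banachHolSpace R :=
  @BanachHolSpace R (davie R) incl incl_inj incl_holomorphic incl_continuous.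
End inclusion.

(** * Polynomials are the finitely supported vectors *)

Section polynomials.
Variable R : realType.
Local Notation C := R[i].
Variables (phi : nat -> index) (psi : index -> nat).
Hypotheses (phiK : cancel phi psi) (psiK : cancel psi phi).
Local Notation X := (davie_hol R psiK).

Lemma level_bound n : exists N, forall m, (m < n)%N -> (tag (phi m) < N)%N.
Proof.
exists (\sum_(m < n) (tag (phi m)).+1)%N => m mn.
by rewrite (bigD1 (Ordinal mn))//= leq_addr.
Qed.

Lemma rank_bound N : exists n, forall k (x : word k), (k < N)%N -> (psi (at_word x) < n)%N.
Proof.
exists (\sum_(k < N) \sum_(x : word k) (psi (at_word x)).+1)%N => k x kN.
by rewrite (bigD1 (Ordinal kN))//= (bigD1 x)//= -addnA leq_addr.
Qed.

Lemma horner_power_sum (p : {poly C}) z : normc z < 1 ->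
  power_sum (nth 0 p) z = p.[z].
Proof.
move=> z1; rewrite (@power_sum_fin _ _ (size p)) ?horner_coef// => n.
by move=> pn; rewrite nth_default.
Qed.

Lemma poly_coef_bounded (p : {poly C}) : coef_bounded (nth 0 p) (\sum_(i < size p) normc p`_i).
Proof.
move=> n; have [np|pn] := ltnP n (size p).
  rewrite (bigD1 (Ordinal np))//= lerDl sumr_ge0// => *; exact: normc_ge0.
by rewrite nth_default// Normc.normc0 sumr_ge0// => *; exact: normc_ge0.
Qed.

Lemma poly_fin_supp (a : index -> C) (p : {poly C}) : (forall n, a (phi n) = p`_n) -> fin_supp a.
Proof.
move=> ap; have [N pN] := level_bound (size p); exists N => k x Nk.
rewrite -(psiK (at_word x)) ap nth_default// leqNgt; apply/negP => /pN.
by rewrite psiK /= ltnNge Nk.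
Qed.

Lemma power_sum_inj (a b : nat -> C) (D D' : R) : coef_bounded a D -> coef_bounded b D' ->
  (forall z, normc z < 1 -> power_sum a z = power_sum b z) -> a =1 b.
Proof.
move=> aD bD ab n; apply/eqP; rewrite -subr_eq0 -opprB oppr_eq0; apply/eqP.
have cD : coef_bounded (fun n => -1 * a n + b n) (D + D').
  by move=> m; rewrite mulN1r (le_trans (normcD _ _))// normcN lerD.
have := @power_sum_coef0 R _ _ cD _ n; rewrite mulN1r addrC; apply => z z1.
by rewrite (power_sum_linear _ aD bD z1) (ab z z1) mulN1r addNr.
Qed.

Lemma represents_polyP (f : X) (p : {poly C}) :
  represents_poly f p <-> forall n, taylor phi f n = p`_n.
Proof.
split=> [fp n|fp z zd].
  apply: (power_sum_inj (taylor_bounded phi f) (poly_coef_bounded p)) => z z1.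
  have zd : unit_disk R z by rewrite unit_diskE.
  by rewrite -inclE// (fp z zd) horner_power_sum.
rewrite /= inclE// (_ : taylor phi f = nth 0 p); last exact/funext.
by apply: horner_power_sum; rewrite -unit_diskE.
Qed.

Lemma polynomialsP (f : X) : polynomials X f <-> fin_supp (dseq f).
Proof.
split=> [[p /represents_polyP fp]|[N fN]]; first exact: poly_fin_supp fp.
have [n nP] := rank_bound N; exists (\poly_(m < n) taylor phi f m).
apply/represents_polyP => m; rewrite coef_poly; case: ltnP => // nm.
rewrite /taylor /=; have := phiK m; case: (phi m) => k x psim; apply: fN.
by rewrite leqNgt; apply/negP => /(nP k x); rewrite psim ltnNge nm.
Qed.

Lemma davie_contains_polynomials : contains_polynomials X.
Proof.
move=> p; pose a i := p`_(psi i).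
have ap n : a (phi n) = p`_n by rewrite /a phiK.
have da : a \in @davie_pred R by apply/davie_predP/fin_supp_approximable/(poly_fin_supp ap).
by exists (Davie da : X); apply/represents_polyP => n; exact: ap.
Qed.

Lemma davie_polynomials_dense : dense (polynomials X).
Proof.
move=> O [f Of] oO.
have /nbhs_ballP[_/= /gt0_complexP[r r0 ->] rO] := open_nbhs_nbhs (conj oO Of).
have r2 : 0 < r / 2 by rewrite divr_gt0.
have [b fb fbr] := davieP f r2.
have db : b \in @davie_pred R by apply/davie_predP/fin_supp_approximable.
exists (Davie db); split; last exact/polynomialsP.
have fb2 : dnorm ((f : davie R) - Davie db) <= r / 2 by apply: dnorm_le => k g; exact: fbr.
apply: rO; rewrite ball_davieE (le_lt_trans fb2)//.
by rewrite ltr_pdivrMr// ltr_pMr// ltr1n.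
Qed.
End polynomials.

(** * Baire category *)

Section baire.
Variable R : realType.
Local Notation C := R[i].
Implicit Types (f h : davie R).

Lemma dnormN f : dnorm (- f) = dnorm f.
Proof. by rewrite -scaleN1r dnormZ normcN Normc.normc1 mul1r. Qed.

Lemma dnormB f h : dnorm (f - h) = dnorm (h - f).
Proof. by rewrite -dnormN opprB. Qed.

Lemma dnorm_triangle h f l : dnorm (f - l) <= dnorm (f - h) + dnorm (h - l).
Proof. by rewrite -(subrKA h) dnormD. Qed.

Lemma closed_ball_avoid (F : set (davie R)) f : closed F -> ~ F f ->
  exists2 r : R, 0 < r & forall h, dnorm (f - h) <= r -> ~ F h.
Proof.
move=> /closed_openC oF nFf.
have /nbhs_ballP[_/= /gt0_complexP[r r0 ->] rF] := open_nbhs_nbhs (conj oF nFf).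
exists (r / 2); first by rewrite divr_gt0.
move=> h fh; apply: rF; rewrite ball_davieE (le_lt_trans fh)//.
by rewrite ltr_pdivrMr// ltr_pMr// ltr1n.
Qed.

(** If no set of the cover contains a ball, nested balls of radius at most [2^-n] can be
chosen so that the ball of index [n.+1] avoids [F n]; their common point lies
in none of the sets. *)
Lemma davie_baire (F : nat -> set (davie R)) : (forall n, closed (F n)) ->
  (forall f, exists n, F n f) ->
  exists n f (r : R), 0 < r /\ forall h, dnorm (f - h) < r -> F n h.
Proof.
move=> cF FT; apply: contrapT => no_ball.
have step n (u : davie R * R) : exists v : davie R * R, 0 < u.2 ->
    [/\ 0 < v.2, v.2 <= u.2 / 2, dnorm (u.1 - v.1) + v.2 <= u.2 &
        forall h, dnorm (v.1 - h) <= v.2 -> ~ F n h].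
  have [u0|] := boolP (0 < u.2); last by exists u.
  have u2 : 0 < u.2 / 2 by rewrite divr_gt0.
  have [h uh nFh] : exists2 h, dnorm (u.1 - h) < u.2 / 2 & ~ F n h.
    apply: contrapT => nh; apply: no_ball; exists n, u.1, (u.2 / 2); split=> // h uh.
    by apply: contrapT => nFh; apply: nh; exists h.
  have [r r0 rF] := closed_ball_avoid (cF n) nFh.
  exists (h, Num.min r (u.2 / 2)) => _; split=> /=.
  - by rewrite lt_min r0.
  - by rewrite ge_min lexx orbT.
  - by rewrite [leRHS]splitr lerD ?(ltW uh)// ge_min lexx orbT.
  - by move=> l hl; apply: rF; rewrite (le_trans hl)// ge_min lexx.
have [next nextP] := choice (fun p : nat * (davie R * R) => step p.1 p.2).
pose u := fix u n := if n is m.+1 then next (m, u m) else (0 : davie R, 1 : R).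
have u0 n : 0 < (u n).2 by elim: n => //= n IH; have [] := nextP (n, _) IH.
have uS n := nextP (n, _) (u0 n).
have nested m n : (m <= n)%N -> dnorm ((u m).1 - (u n).1) + (u n).2 <= (u m).2.
  elim: n => [|n IH].
    by rewrite leqn0 => /eqP ->; rewrite subrr dnorm0 add0r.
  rewrite leq_eqVlt => /orP[/eqP ->|].
    by rewrite subrr dnorm0 add0r.
  rewrite ltnS => /IH; apply: le_trans.
  have [_ _ h _] := uS n; rewrite -[(u n.+1)]/(next (n, u n)).
  rewrite (le_trans (lerD (dnorm_triangle (u n).1 _ _) (lexx _)))//.
  by rewrite -addrA lerD2l.
have r2 n : (u n).2 <= 1 / 2 ^+ n.
  elim: n => [|n IH]; first by rewrite /= expr0 divr1.
  have [_ h _ _] := uS n; rewrite (le_trans h)// exprSr invfM [leRHS]mulrA ler_pM2r//.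
have cvg_r : (u n).2 @[n --> \oo] --> 0.
  apply: (@squeeze_cvgr _ _ _ _ (fun=> 0) (fun n => 1 / 2 ^+ n)).
  - by apply: nearW => n; rewrite r2 ltW.
  - exact: cvg_cst.
  - exact: cvg_div_exp2.
have dist m n : (m <= n)%N -> dnorm ((u m).1 - (u n).1) <= (u m).2.
  by move=> mn; rewrite (le_trans _ (nested m n mn))// lerDl ltW.
have [l ul] := davie_cauchy_limit (u := fun n => (u n).1) cvg_r dist.
have [n Fnl] := FT l; have [_ _ _ avoid] := uS n.
exact: avoid (ul n.+1) Fnl.
Qed.
End baire.

(** * Consequences for the operators of a scheme *)

Section operators.
Variable R : realType.
Local Notation C := R[i].
Implicit Types (f h : davie R) (T : {linear davie R -> davie R}).

Lemma closed_lipschitz_le (q : davie R -> R) (c : R) :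
  (forall f h, q h <= q f + dnorm (f - h)) -> closed [set f | q f <= c].
Proof.
move=> qL; rewrite -openC openE => f /= /negP; rewrite -ltNge => cf.
apply/nbhs_ballP; exists (q f - c)%:C; first by rewrite /= ltcR subr_gt0.
move=> h; rewrite ball_davieE => fh /=; apply/negP; rewrite -ltNge.
by have := qL h f; rewrite dnormB; lra.
Qed.

Definition coef i f : C := dseq f i.

Lemma closed_preimage_lipschitz_le T (q : davie R -> R) (c : R) : continuous T ->
  (forall f h, q h <= q f + dnorm (f - h)) -> closed [set f | q (T f) <= c].
Proof.
move=> cT qL; rewrite (_ : [set f | _] = T @^-1` [set f | q f <= c])//.
apply: closed_comp; last exact: closed_lipschitz_le.
by move=> f _; exact: cT.
Qed.

(** Uniform boundedness: one of the closed sets of vectors with orbit bounded by [m]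
contains a ball, and linearity transfers the bound to the whole space. *)
Lemma uniform_bound (T : nat -> {linear davie R -> davie R}) :
  (forall n, continuous (T n)) -> (forall f, T n f @[n --> \oo] --> f) ->
  exists2 M : R, 0 <= M &
    forall n f (d : R), 0 < d -> dnorm f <= d -> dnorm (T n f) <= M * d.
Proof.
move=> cT Tid; pose F m := [set f | forall n, dnorm (T n f) <= m%:R].
have cF m : closed (F m).
  rewrite (_ : F m = \bigcap_n [set f | dnorm (T n f) <= m%:R]); last first.
    by apply/seteqP; split=> [f Ff n _|f Ff n]; [exact: Ff | exact: Ff n I].
  apply: closed_bigI => n _; apply: closed_preimage_lipschitz_le => // f h.
  by rewrite -{1}(subrK f h) addrC (le_trans (dnormD _ _))// lerD2l dnormB.
have FT f : exists m, F m f.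
  have /cvg_ballP/(_ 1 ltr01)[N _ fN] := Tid f.
  pose B := dnorm f + 1 + \sum_(n < N) dnorm (T n f).
  exists (Num.Def.truncn B).+1 => n; apply: (@le_trans _ _ B); last exact/ltW/truncnS_gt.
  have [nN|Nn] := ltnP n N.
    rewrite /B (bigD1 (Ordinal nN))//= addrCA lerDl addr_ge0//.
      by rewrite addr_ge0// dnorm_ge0.
    by rewrite sumr_ge0// => *; exact: dnorm_ge0.
  have := fN n Nn; rewrite /= -[1%R]/(1%:C) ball_davieE => h.
  rewrite /B -[leLHS]addr0 lerD ?sumr_ge0// => [|*]; last exact: dnorm_ge0.
  rewrite -(subrK f (T n f)) addrC (le_trans (dnormD _ _))// lerD2l.
  by rewrite dnormB ltW.
have [m [f0 [r [r0 ball]]]] := davie_baire cF FT.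
(* The vector [t f] has norm at most [r / 2], so [T n] maps it to a vector of norm at
   most [2 m]. *)
exists (m%:R * 4 / r) => [|n f d d0 fd]; first by rewrite divr_ge0 ?mulr_ge0 ?ler0n// ltW.
pose t := r / (2 * d); have t0 : 0 < t by rewrite divr_gt0// mulr_gt0.
have nt := normc_gt0 t0.
have h1 : dnorm (T n (f0 + t%:C *: f)) <= m%:R.
  apply: ball; rewrite opprD addNKr dnormN dnormZ nt.
  rewrite (@le_lt_trans _ _ (t * d)) ?ler_wpM2l ?(ltW t0)//.
  by rewrite /t -mulrA invfM divfK ?gt_eqF// ltr_pdivrMr// ltr_pMr// ltr1n.
have h0 : dnorm (T n f0) <= m%:R by apply: ball; rewrite subrr dnorm0.
have : t * dnorm (T n f) <= m%:R + m%:R.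
  rewrite -{1}nt -dnormZ -linearZ -[t%:C *: f](addKr f0) linearD linearN addrC.
  by rewrite (le_trans (dnormD _ _))// dnormN lerD.
rewrite -ler_pdivlMl// => /le_trans; apply.
rewrite [leLHS](_ : _ = m%:R * 4 / r * d)// /t; field.
by rewrite !gt_eqF.
Qed.

(** The vectors whose image lives below level [N] form closed subspaces that cover the
space; the one that contains a ball is everything. *)
Lemma finite_level T : continuous T -> (forall f, fin_supp (dseq (T f))) ->
  exists N, forall f k (x : word k), (N <= k)%N -> T f (at_word x) = 0.
Proof.
move=> cT fT.
pose F N := [set f | forall k (x : word k), (N <= k)%N -> T f (at_word x) = 0].
have cF N : closed (F N).
  rewrite (_ : F N = \bigcap_(i in [set i | (N <= tag i)%N])
                       [set f | normc (T f i) <= 0]); last first.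
    apply/seteqP; split=> [f Ff [k x] /= Nk|f Ff k x Nk].
      by rewrite [dseq _ _]Ff// Normc.normc0.
    by apply/Normc.eq0_normc/eqP; rewrite eq_le normc_ge0 andbT; exact: (Ff (at_word x) Nk).
  apply: closed_bigI => -[k x] _.
  apply: (@closed_preimage_lipschitz_le _ (fun f => normc (f (existT _ k x)))) => // f h.
  rewrite -lerBlDl (le_trans _ (coef_le_dnorm (f - h) x))// normcB.
  have := normcD (h (at_word x) - f (at_word x)) (f (at_word x)).
  by rewrite subrK; lra.
have [N [f0 [r [r0 ball]]]] := davie_baire cF fT.
exists N => f k x Nk; have d0 : 0 < dnorm f + 1 by rewrite ltr_wpDl// dnorm_ge0.
pose t := r / (dnorm f + 1); have t0 : 0 < t by rewrite divr_gt0.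
have nt := normc_gt0 t0.
have h1 : F N (f0 + t%:C *: f).
  apply: ball; rewrite opprD addNKr dnormN dnormZ nt.
  by rewrite /t mulrAC ltr_pdivrMr// ltr_pM2l// ltrDl.
have h0 : F N f0 by apply: ball; rewrite subrr dnorm0.
have := h1 k x Nk; rewrite linearD linearZ.
have -> : dseq (T f0 + t%:C *: T f) (at_word x) = T f0 (at_word x) + t%:C * T f (at_word x) by [].
rewrite (h0 k x Nk) add0r => /eqP; rewrite mulf_eq0 => /orP[|/eqP//].
by rewrite eq_complex /= gt_eqF.
Qed.
End operators.

(** * Block traces *)

Section trace.
Variable R : realType.
Local Notation C := R[i].
Implicit Types (f h : davie R) (T : {linear davie R -> davie R}).

Lemma coef_is_linear i : linear_for *%R (coef i : davie R -> C).
Proof. by []. Qed.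
HB.instance Definition _ i :=
  GRing.isLinear.Build C (davie R) C *%R (coef i) (coef_is_linear i).

Lemma coefB i f h : coef i (f - h) = coef i f - coef i h. Proof. by []. Qed.
Lemma coefZ i c f : coef i (c *: f) = c * coef i f. Proof. by []. Qed.

(** The values as linear forms on the space. *)
Definition value k (g : point k) f : C := ev f g.

Lemma value_is_linear k (g : point k) : linear_for *%R (value g).
Proof. by move=> c f h; rewrite /value [LHS]evD [ev (_ *: _) g]evZ. Qed.
HB.instance Definition _ k (g : point k) :=
  GRing.isLinear.Build C (davie R) C *%R (value g) (value_is_linear g).

Definition unit_seq k (x : word k) : index -> C := fun i => (i == at_word x)%:R.

Lemma unit_seq_davie k (x : word k) : unit_seq x \in @davie_pred R.
Proof.
apply/davie_predP/fin_supp_approximable; exists k.+1 => j w kj.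
rewrite /unit_seq; case: eqP => // e.
by move/(congr1 (@tag _ _)) : e => /= e; rewrite e ltnn in kj.
Qed.
Definition unit_vec k (x : word k) : davie R := Davie (unit_seq_davie x).

Lemma coef_unit k (w x : word k) : coef (at_word w) (unit_vec x) = (w == x)%:R.
Proof. by rewrite /coef /= /unit_seq eq_Tagged. Qed.

Lemma coef_unit_neq k j (w : word j) (x : word k) : j != k ->
  coef (at_word w) (unit_vec x) = 0.
Proof.
move=> jk; rewrite /coef /= /unit_seq; case: eqP => // e.
by move/(congr1 (@tag _ _)) : e jk => /= ->; rewrite eqxx.
Qed.

Definition block_trace k T : C :=
  #|word k|%:R^-1 * \sum_(x : word k) coef (at_word x) (T (unit_vec x)).

(** The vector at which consecutive traces are compared, see [block_trace_step]. *)
Definition test_vec k (g : point k) : davie R :=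
  (#|word k.+1|%:R^-1 : C) *: (\sum_(y : word k.+1) tau C y g *: unit_vec y) -
  (#|word k|%:R^-1 : C) *: (\sum_(x : word k) sigma C x g *: unit_vec x).

(** The coordinates of level [k.+1] are read through [tau] and those of level [k] through
[sigma], both at the points of level [k]. *)
Lemma block_trace_step k T : block_trace k.+1 T - block_trace k T =
  #|point k|%:R^-1 * \sum_(g : point k) value g (T (test_vec g)).
Proof.
have e1 (y : word k.+1) : coef (at_word y) (T (unit_vec y)) =
    #|point k|%:R^-1 * \sum_(g : point k) tau C y g * value g (T (unit_vec y)).
  by rewrite /coef coef_ev_tau.
have e2 (x : word k) : coef (at_word x) (T (unit_vec x)) =
    #|point k|%:R^-1 * \sum_(g : point k) sigma C x g * value g (T (unit_vec x)).
  by rewrite /coef coef_ev.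
rewrite /block_trace (eq_bigr _ (fun y _ => e1 y)) (eq_bigr _ (fun x _ => e2 x)).
rewrite -!mulr_sumr mulrCA [X in _ - X]mulrCA -mulrBr; congr (_ * _).
rewrite exchange_big /= [X in _ - _ * X]exchange_big /= !mulr_sumr -sumrB.
apply: eq_bigr => g _; rewrite /test_vec linearB linearB !linearZ !linear_sum /=.
by congr (_ * _ + _ *: _); apply: eq_bigr => y _; rewrite !linearZ.
Qed.

Lemma coef_sum_unit k (c : word k -> C) j (w : word j) :
  coef (at_word w) (\sum_(x : word k) c x *: unit_vec x) =
  \sum_(x : word k) c x * coef (at_word w) (unit_vec x).
Proof. by rewrite linear_sum; apply: eq_bigr => x _; rewrite linearZ. Qed.

Lemma coef_sum_unit_eq k (c : word k -> C) (w : word k) :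
  coef (at_word w) (\sum_(x : word k) c x *: unit_vec x) = c w.
Proof.
rewrite coef_sum_unit (bigD1 w)// coef_unit eqxx mulr1 big1 => [|x xw].
  exact: addr0.
by rewrite coef_unit eq_sym (negbTE xw) mulr0.
Qed.

Lemma coef_sum_unit_neq k (c : word k -> C) j (w : word j) : j != k ->
  coef (at_word w) (\sum_(x : word k) c x *: unit_vec x) = 0.
Proof. by move=> jk; rewrite coef_sum_unit big1// => x _; rewrite coef_unit_neq ?mulr0. Qed.

Lemma coef_test_tau k (g : point k) (y : word k.+1) :
  coef (at_word y) (test_vec g) = #|word k.+1|%:R^-1 * tau C y g.
Proof.
by rewrite coefB !coefZ coef_sum_unit_eq coef_sum_unit_neq ?mulr0 ?subr0// gtn_eqF.
Qed.

Lemma coef_test_sigma k (g : point k) (x : word k) :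
  coef (at_word x) (test_vec g) = - (#|word k|%:R^-1 * sigma C x g).
Proof.
by rewrite coefB !coefZ coef_sum_unit_neq ?coef_sum_unit_eq ?mulr0 ?sub0r// ltn_eqF.
Qed.

Lemma coef_test_0 k (g : point k) j (w : word j) : j != k -> j != k.+1 ->
  coef (at_word w) (test_vec g) = 0.
Proof.
by move=> jk jk1; rewrite coefB !coefZ !coef_sum_unit_neq ?mulr0 ?subr0.
Qed.

Lemma valueE k (g : point k) f : value g f =
  \sum_(x : word k) coef (at_word x) f * sigma C x g +
  \sum_(y : word k.+1) coef (at_word y) f * tau C y g.
Proof. by []. Qed.

Lemma lec_normc (z : C) (r : R) : (normc z <= r) = (`|z| <= r%:C).
Proof. by rewrite normcE lecR. Qed.

(** The test vector lives on the levels [k] and [k.+1], so only the points of the levels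
[k - 1], [k] and [k + 1] see it. At level [k] the contributions of [tau] and
[sigma] nearly cancel; at the two others one coherence of [tau] with [sigma]
remains. *)
Lemma dnorm_test k (g : point k) : dnorm (test_vec g) <= 2 / 2 ^+ k.
Proof.
apply: dnorm_le => j h; rewrite -/(value h _) valueE lec_normc rmorphM fmorphV rmorphXn rmorph_nat.
have [jk|jk] := eqVneq j k.
  subst j; rewrite addrC; under eq_bigr do rewrite coef_test_tau -mulrA.
  under [X in _ + X]eq_bigr do rewrite coef_test_sigma mulNr -mulrA.
  by rewrite sumrN -!mulr_sumr tau_sub_sigma_coherence.
have [jk1|jk1] := eqVneq j k.+1.
  subst j; rewrite [X in _ + X]big1 ?addr0 => [|y _]; last first.
    by rewrite coef_test_0 ?mul0r// ?gtn_eqF.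
  under eq_bigr do rewrite coef_test_tau -mulrA.
  rewrite -mulr_sumr (le_trans (tau_sigma_coherence _ _ _))// exprS invfM.
  by rewrite ler_wpM2r ?invr_ge0 ?exprn_ge0// (@le_trans _ _ 1) ?invf_le1 ?ler1n.
rewrite big1 ?add0r => [|x _]; last by rewrite coef_test_0 ?mul0r.
have [jSk|jSk] := eqVneq j.+1 k; last first.
  by rewrite big1 ?normr0 ?divr_ge0 ?exprn_ge0// => y _; rewrite coef_test_0 ?mul0r.
subst k; under eq_bigr do rewrite coef_test_sigma mulNr -mulrA mulrC.
rewrite sumrN normrN -mulr_suml mulrC.
under eq_bigr do rewrite mulrC.
rewrite (le_trans (tau_sigma_coherence _ _ _))//.
by rewrite ler_peMl ?invr_ge0 ?exprn_ge0// ler1n.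
Qed.

Lemma block_trace_step_le k T (M : R) :
  (forall f (d : R), 0 < d -> dnorm f <= d -> dnorm (T f) <= M * d) ->
  normc (block_trace k.+1 T - block_trace k T) <= M * (2 / 2 ^+ k).
Proof.
move=> TM; rewrite block_trace_step; apply: normc_avg_le => g.
rewrite (le_trans (ev_le_dnorm _ _))// TM ?divr_gt0 ?exprn_gt0//.
exact: dnorm_test.
Qed.

(** The steps are dominated by a geometric series. *)
Lemma block_trace_tail k j T (M : R) : 0 <= M ->
  (forall f (d : R), 0 < d -> dnorm f <= d -> dnorm (T f) <= M * d) ->
  normc (block_trace (k + j) T - block_trace k T) <=
  M * (4 / 2 ^+ k) - M * (4 / 2 ^+ (k + j)).
Proof.
move=> M0 TM; elim: j => [|j IH]; first by rewrite addn0 !subrr Normc.normc0.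
rewrite (le_trans (normc_triangle (block_trace (k + j) T) _ _))// addnS.
rewrite (le_trans (lerD (block_trace_step_le (k + j) TM) IH))//.
rewrite [leLHS](_ : _ = M * (4 / 2 ^+ k) - M * (4 / 2 ^+ (k + j).+1))//.
by rewrite exprS; field; rewrite !expf_neq0.
Qed.

(** For a fixed level [K] the traces tend to 1 along the scheme, whereas [finite_level]
and [block_trace_tail] bound all of them by 1/2. *)
Lemma davie_no_finite_scheme (T : nat -> {linear davie R -> davie R}) :
  (forall n, continuous (T n)) -> (forall n f, fin_supp (dseq (T n f))) ->
  (forall f, T n f @[n --> \oo] --> f) -> False.
Proof.
move=> cT fT Tid; have [M M0 TM] := uniform_bound cT Tid.
have /cvgrPdist_lt/(_ (1 / 2))[//|K _ /(_ K (leqnn K))] := cvg_div_exp2 (M * 4).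
rewrite sub0r normrN => /(le_lt_trans (ler_norm _)) K2.
have trace_small n : normc (block_trace K (T n)) <= 1 / 2.
  have [N TN] := finite_level (cT n) (fT n).
  have := block_trace_tail K N M0 (TM n).
  rewrite [block_trace (K + N) (T n)](_ : _ = 0) => [|]; last first.
    by rewrite /block_trace big1 ?mulr0// => x _; apply: TN; rewrite leq_addl.
  rewrite sub0r normcN => /le_trans; apply; rewrite lerBlDr.
  rewrite mulrA ltW// (lt_le_trans K2)// lerDl mulr_ge0// divr_ge0// exprn_ge0//.
have : \forall n \near \oo, forall x : word K, dnorm (unit_vec x - T n (unit_vec x)) < 1 / 4.
  apply: filter_forall => x; have r0 : (0 : C) < (1 / 4 : R)%:C by rewrite ltcR.
  have /cvg_ballP/(_ _ r0) := Tid (unit_vec x).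
  by apply: filterS => n; rewrite ball_davieE.
move=> [n _ /(_ n (leqnn n)) Tn].
have : normc (1 - block_trace K (T n)) <= 1 / 4.
  have w0 : #|word K|%:R != 0 :> C by rewrite pnatr_eq0 card_word expn_eq0.
  have -> : 1 - block_trace K (T n) = #|word K|%:R^-1 *
      \sum_(x : word K) coef (at_word x) (unit_vec x - T n (unit_vec x)).
    under eq_bigr do rewrite coefB coef_unit eqxx.
    by rewrite sumrB mulrBr sumr_const mulVf.
  rewrite lec_normc normrM normfV normr_nat ler_pdivrMl ?lt_def ?w0 ?ler0n//.
  rewrite (le_trans (ler_norm_sum _ _ _))// mulr_natl -sumr_const.
  apply: ler_sum => x _; rewrite -lec_normc (le_trans (coef_le_dnorm _ _))//.
  exact/ltW/Tn.
have := normcD (1 - block_trace K (T n)) (block_trace K (T n)).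
by rewrite subrK Normc.normc1; have := trace_small n; lra.
Qed.
End trace.

Theorem corollary1p4 (R : realType) :
  exists X : banachHolSpace R,
    [/\ contains_polynomials X,
        dense (polynomials X)
      & ~ exists T : nat -> {linear X -> X}, linear_poly_approx_scheme T].
Proof.
have [phi [psi [phiK psiK]]] := index_enum.
exists (davie_hol R psiK); split.
- exact: davie_contains_polynomials.
- exact: davie_polynomials_dense.
move=> [T [cT pT Tid]]; apply: (@davie_no_finite_scheme R T cT) => // n f.
exact/(polynomialsP phiK).
Qed.
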